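(* Let $a\in(0,1)$ and let $g\in C^2([0,1])$ be a bistable nonlinearity, i.e. $g(0)=g(a)=g(1)=0$ and there are $0<a_1<a<a_2<1$ such that $g'(u)<0$ for $u\in[0,a_1)\cup(a_2,1]$ and $g'(u)>0$ for $u\in(a_1,a_2)$. Let $d>0$ be sufficiently small (i.e. there is $d_0>0$ depending on $g$ such that the following holds for all $d\in(0,d_0)$), and let $u=(u_i)_{i\in\mathbb Z}$ be a stationary solution of the lattice equation $$u_i'(t)=d(u_{i-1}(t)-2u_i(t)+u_{i+1}(t))+g(u_i(t)),\qquad i\in\mathbb Z,\ t\ge0,$$ corresponding to $s\in\Sigma_3=\{0,a,1\}^{\mathbb Z}$. (i) If $u_i\in[0,a_1)\cup(a_2,1]$ (or equivalently $s_i\in\{0,1\}$) for all $i\in\mathbb Z$, then $u$ is locally asymptotically $\ell^2$-stable. (ii) If there exists an index $i_0\in\mathbb Z$ such that $u_{i_0}\in(a_1,a_2)$ (or equivalently $s_{i_0}=a$), then $u$ is $\ell^2$-unstable.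
   Context: Correspondence with symbolic sequences. Put $Q=[0,1]^2$ and $h(u)=2u-\frac1d g(u)$. For $d$ sufficiently small, each of the equations $h(u)=0$, $h(u)=1$, $h(u)=2$ has exactly three roots in $[0,1]$: $\mathrm u_0<\mathrm u_5<\mathrm u_6$ for $h=0$, $\mathrm u_1<\mathrm u_4<\mathrm u_7$ for $h=1$, $\mathrm u_2<\mathrm u_3<\mathrm u_8$ for $h=2$, and $0=\mathrm u_0<\mathrm u_1<\dots<\mathrm u_8=1$. Define $$U_0=\{(x,y)\in Q: y\in[0,\mathrm u_2],\ 0\le h(y)-x\le1\},$$ $$U_a=\{(x,y)\in Q: y\in[\mathrm u_3,\mathrm u_5],\ 0\le h(y)-x\le1\},$$ $$U_1=\{(x,y)\in Q: y\in[\mathrm u_6,1],\ 0\le h(y)-x\le1\}.$$ A stationary solution $u=(u_i)$, $u_i\in[0,1]$, i.e. a solution of $d(u_{i-1}-2u_i+u_{i+1})+g(u_i)=0$ for all $i\in\mathbb Z$, corresponds to $s\in\Sigma_3$ if $(u_{i+1},u_i)\in U_{s_i}$ for all $i\in\mathbb Z$. Stability. The function $g$ is extended to a function $g\in C^2(\mathbb R)$ with $g(u)>0$ for $u<0$, $g(u)<0$ for $u>1$, and $|g''|\le M$ on $\mathbb R$ for some $M>0$. For a stationary solution $u$ and $\psi^0\in\ell^2(\mathbb Z)$ consider the perturbation $\psi(t)=\chi(t)-u$ of the solution $\chi$ of the lattice equation with $\chi(0)=u+\psi^0$, i.e. the classical solution $\psi$ in $\ell^2(\mathbb Z)$ of $$\psi_i'(t)=d(\psi_{i-1}-2\psi_i+\psi_{i+1})+g(u_i+\psi_i)-g(u_i),\quad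 i\in\mathbb Z,\qquad \psi(0)=\psi^0 .$$ - $u$ is locally $\ell^2$-stable if for every $\varepsilon>0$ there is $\delta>0$ such that $\|\psi^0\|_{\ell^2}<\delta$ implies $\|\psi(t)\|_{\ell^2}<\varepsilon$ for all $t\in[0,\infty)$. - $u$ is locally asymptotically $\ell^2$-stable if it is locally $\ell^2$-stable and there is $\gamma>0$ such that $\|\psi^0\|_{\ell^2}<\gamma$ implies $\|\psi(t)\|_{\ell^2}\to0$ as $t\to\infty$. - $u$ is $\ell^2$-unstable if it is not locally $\ell^2$-stable. *)

(* Defs.v *)
From HB Require Import structures.
From mathcomp Require Import all_boot all_order all_algebra.
From mathcomp Require Import all_classical all_reals all_analysis.

Set Implicit Arguments.
Unset Strict Implicit.
Unset Printing Implicit Defensive.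

Import Order.TTheory GRing.Theory Num.Theory.
Import numFieldNormedType.Exports.

Local Open Scope ring_scope.
Local Open Scope classical_set_scope.

Section Nonlinearity.
Variable R : realType.
Implicit Types (f g ge : R -> R) (a d x y : R).

(* Derivative relative to a set; one-sided at the end points of an interval. *)
Definition is_derive_within (A : set R) f x (l : R) : Prop :=
  (f y - f x) / (y - x) @[y --> within A x^'] --> l.

(* f is C^2 on [0, 1], with first and second derivatives f1 and f2 there. *)
Definition C2_unit_interval f f1 f2 : Prop :=
  [/\ forall x, 0 <= x <= 1 -> is_derive_within `[0, 1] f x (f1 x),
      forall x, 0 <= x <= 1 -> is_derive_within `[0, 1] f1 x (f2 x)
    & {within `[0, 1], continuous f2}].

Definition bistable g g1 a a1 a2 : Prop :=
  [/\ [/\ g 0 = 0, g a = 0 & g 1 = 0],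
      [/\ 0 < a1, a1 < a, a < a2 & a2 < 1],
      forall x, (0 <= x < a1) || (a2 < x <= 1) -> g1 x < 0
    & forall x, a1 < x < a2 -> 0 < g1 x].

Definition admissible_extension g ge : Prop :=
  [/\ forall x, 0 <= x <= 1 -> ge x = g x,
      [/\ forall x, derivable ge x 1, forall x, derivable ge^`() x 1
        & continuous ge^`(2)],
      forall x, x < 0 -> 0 < ge x,
      forall x, 1 < x -> ge x < 0
    & exists2 M : R, 0 < M & forall x, `|ge^`(2) x| <= M].

Definition hfun g d x : R := 2 * x - d^-1 * g x.

Definition key_roots g d (r : 9.-tuple R) : Prop :=
  [/\ forall x, 0 <= x <= 1 ->
        (hfun g d x = 0 <-> x \in [:: r`_0; r`_5; r`_6]),
      forall x, 0 <= x <= 1 ->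
        (hfun g d x = 1 <-> x \in [:: r`_1; r`_4; r`_7]),
      forall x, 0 <= x <= 1 ->
        (hfun g d x = 2 <-> x \in [:: r`_2; r`_3; r`_8]),
      sorted <%R r
    & r`_0 = 0 /\ r`_8 = 1].

Inductive symbol := sym0 | syma | sym1.

Definition Uset g d (r : 9.-tuple R) (s : symbol) : set (R * R) :=
  [set p | [/\ 0 <= p.1 <= 1, 0 <= p.2 <= 1,
     match s with
     | sym0 => 0 <= p.2 <= r`_2
     | syma => r`_3 <= p.2 <= r`_5
     | sym1 => r`_6 <= p.2 <= 1
     end
     & 0 <= hfun g d p.2 - p.1 <= 1]].

Definition stationary_solution g d (u : int -> R) : Prop :=
  (forall i, 0 <= u i <= 1) /\
  (forall i : int, d * (u (i - 1) - 2 * u i + u (i + 1)) + g (u i) = 0).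

Definition corresponds g d (r : 9.-tuple R) (u : int -> R)
    (s : int -> symbol) : Prop :=
  forall i, Uset g d r (s i) (u (i + 1), u i).

End Nonlinearity.

Section Stability.
Variable R : realType.
Implicit Types (x u : int -> R) (psi : R -> int -> R) (g : R -> R).
Implicit Types (d t : R).

Definition in_l2 x : Prop :=
  (\esum_(i in [set: int]) (x i ^+ 2)%:E < +oo)%E.

(* Only meaningful for members of l^2: [fine] sends +oo to 0. *)
Definition l2norm x : R :=
  Num.sqrt (fine (\esum_(i in [set: int]) (x i ^+ 2)%:E)).

Definition perturbation_field d g u x : int -> R :=
  fun i => d * (x (i - 1) - 2 * x i + x (i + 1)) + g (u i + x i) - g (u i).

(* psi belongs to C^1([0, +oo); l^2) (one-sided derivative at 0) and solves
   psi' = perturbation_field d g u psi in l^2, with psi(0) = psi0. Values of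
   psi at negative times are irrelevant. *)
Definition classical_solution d g u (psi0 : int -> R) psi : Prop :=
  let F := perturbation_field d g u in
  [/\ psi 0 = psi0,
      forall t, 0 <= t -> in_l2 (psi t),
      forall t, 0 <= t -> in_l2 (F (psi t)),
      forall t, 0 <= t ->
        l2norm (fun i => (psi t' i - psi t i) / (t' - t) - F (psi t) i)
          @[t' --> within `[0, +oo[ t^'] --> 0
    & forall t, 0 <= t ->
        l2norm (fun i => F (psi t') i - F (psi t) i)
          @[t' --> within `[0, +oo[ (nbhs t)] --> 0].

(* "The solution issued from psi0 satisfies P": it exists on all of [0, +oo)
   and P holds for it; in particular a solution that ceased to exist in finite
   time would not count as stable. *)
Definition solution_satisfies d g u (psi0 : int -> R)
    (P : (R -> int -> R) -> Prop) : Prop :=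
  (exists psi, classical_solution d g u psi0 psi) /\
  (forall psi, classical_solution d g u psi0 psi -> P psi).

Definition locally_l2_stable d g u : Prop :=
  forall eps : R, 0 < eps -> exists2 delta : R, 0 < delta &
    forall psi0 : int -> R, in_l2 psi0 -> l2norm psi0 < delta ->
      solution_satisfies d g u psi0
        (fun psi => forall t, 0 <= t -> l2norm (psi t) < eps).

Definition locally_asymptotically_l2_stable d g u : Prop :=
  locally_l2_stable d g u /\
  exists2 gamma : R, 0 < gamma &
    forall psi0 : int -> R, in_l2 psi0 -> l2norm psi0 < gamma ->
      solution_satisfies d g u psi0
        (fun psi => l2norm (psi t) @[t --> +oo] --> 0).

Definition l2_unstable d g u : Prop := ~ locally_l2_stable d g u.

End Stability.

(* Main.v *)
Require Import Defs.
From HB Require Import structures.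
From mathcomp Require Import all_boot all_order all_algebra.
From mathcomp Require Import all_classical all_reals all_analysis.
From mathcomp Require Import finmap ring lra.

Set Implicit Arguments.
Unset Strict Implicit.
Unset Printing Implicit Defensive.

Import Order.TTheory GRing.Theory Num.Theory.
Import numFieldNormedType.Exports.

Local Open Scope ring_scope.
Local Open Scope classical_set_scope.

(** For small [d] the slope of [g] dominates the coupling. Sites outside
    [[a1, a2]] have slopes bounded above by some [- 2 k < 0]; since an explicit
    Euler step of the discrete Laplacian is a convex combination of shifts, the
    logarithmic norm of the perturbation field on [l^2] is at most [- k] near 0,
    and a Dini argument yields exponential decay. Solutions exist by Picard
    iteration for the field whose nonlinearity is clamped to the ball that the
    decay estimate makes invariant. If some site has slope larger than [2 d],
    perturb that site alone by a positive amount: the perturbation stays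
    nonnegative, so the neighbours only help, and the perturbed coordinate [q]
    satisfies [q' >= nu q] as long as it is small, so it cannot stay small. *)

(** Infinitely many sites create two obstacles. A negative slope of [g] at each site gives no common
    bound [- 2 k], since the values [u i] could accumulate at [a1] or [a2]; the correspondence with
    [s] excludes this by keeping the stable sites in two compact intervals ending at key roots. And
    an infimum over all sites need not be attained, so the sign of a perturbation cannot be read off
    at a minimal site; a crude lower bound is improved repeatedly instead. The threshold [2 * d] is
    the diagonal coefficient of the coupling, the most that a site can lose to nonnegative
    neighbours; [d0] is chosen so that the slope exceeds it on the whole interval that contains the
    sites with symbol [syma]. Picard iteration only solves the clamped equation. The decay estimate
    is therefore stated for an abstract field: it serves once to remove the clamp, and once more for
    an arbitrary classical solution. *)

(** * Norm bounds in l^2 through finite partial sums *)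

Section SquareSummable.
Variable R : realType.
Implicit Types (x y : int -> R) (A B c : R).

(** Summability and an upper bound for the norm in one predicate. Testing finite sums only reduces
    every estimate to finite algebra and keeps clear of the default value of [l2norm] outside
    l^2. *)
Definition l2le x B : Prop :=
  0 <= B /\ forall J : seq int, uniq J -> \sum_(i <- J) x i ^+ 2 <= B ^+ 2.

Lemma l2le_ge0 x B : l2le x B -> 0 <= B. Proof. by case. Qed.

Lemma l2le_in_l2 x B : l2le x B -> in_l2 x /\ l2norm x <= B.
Proof.
move=> [B0 xB].
have le : (\esum_(i in [set: int]) (x i ^+ 2)%:E <= (B ^+ 2)%:E)%E.
  apply: ge_ereal_sup => _ [X [finX _] <-].
  rewrite fsbig_finite//= sumEFin lee_fin.
  exact/xB/fset_uniq.
have ge : (0 <= \esum_(i in [set: int]) (x i ^+ 2)%:E)%E.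
  by apply: esum_ge0 => i _; rewrite lee_fin sqr_ge0.
have fin : (\esum_(i in [set: int]) (x i ^+ 2)%:E < +oo)%E.
  exact: le_lt_trans le (ltry _).
split=> //; rewrite /l2norm -(ger0_norm B0) -sqrtr_sqr ler_wsqrtr//.
by rewrite -lee_fin fineK// ge0_fin_numE.
Qed.

Lemma in_l2_l2le x : in_l2 x -> l2le x (l2norm x).
Proof.
move=> x2; split; first exact: sqrtr_ge0.
have ge : (0 <= \esum_(i in [set: int]) (x i ^+ 2)%:E)%E.
  by apply: esum_ge0 => i _; rewrite lee_fin sqr_ge0.
move=> J uJ; rewrite /l2norm sqr_sqrtr ?fine_ge0//.
rewrite -lee_fin fineK ?ge0_fin_numE//.
apply: ereal_sup_ubound; exists [set` J].
  by split => //; exact: finite_seq.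
by rewrite -fsbig_seq// sumEFin.
Qed.

Lemma le_l2le x A B : A <= B -> l2le x A -> l2le x B.
Proof.
move=> AB [A0 xA]; split; first exact: le_trans AB.
move=> J uJ; apply: le_trans (xA J uJ) _.
by rewrite lerXn2r// nnegrE// (le_trans A0).
Qed.

Lemma dominated_l2le x y B :
  (forall i, `|y i| <= `|x i|) -> l2le x B -> l2le y B.
Proof.
move=> yx [B0 xB]; split=> // J uJ; apply: le_trans (xB J uJ).
apply: ler_sum => i _.
by rewrite -real_normK ?num_real// -[leRHS]real_normK ?num_real// lerXn2r// nnegrE.
Qed.

Lemma eq_l2le x y B : x =1 y -> l2le x B -> l2le y B.
Proof. by move=> xy; apply: dominated_l2le => i; rewrite xy. Qed.

Lemma l2le_coord x B i : l2le x B -> `|x i| <= B.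
Proof.
move=> [B0 /(_ [:: i] erefl)]; rewrite big_seq1 => xB.
by rewrite -(ger0_norm B0) -ler_sqr ?nnegrE// !real_normK ?num_real.
Qed.

Lemma l2le0 : l2le (fun=> 0) 0.
Proof. by split=> // J _; rewrite big1// => i _; rewrite expr0n. Qed.

Lemma l2leZ c x B : l2le x B -> l2le (fun i => c * x i) (`|c| * B).
Proof.
move=> [B0 xB]; split; first exact: mulr_ge0.
move=> J uJ; rewrite exprMn real_normK ?num_real//.
under eq_bigr do rewrite exprMn.
by rewrite -mulr_sumr ler_wpM2l ?sqr_ge0// xB.
Qed.

(* Minkowski's inequality, from (x + y)^2 <= (1 + B/A) x^2 + (1 + A/B) y^2. *)
Lemma l2leD x y A B : l2le x A -> l2le y B -> l2le (fun i => x i + y i) (A + B).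
Proof.
move=> xA yB; have A0 := l2le_ge0 xA; have B0 := l2le_ge0 yB.
have [AE|Ane] := eqVneq A 0.
  rewrite AE add0r; apply: eq_l2le yB => i.
  by have := l2le_coord i xA; rewrite AE normr_le0 => /eqP ->; rewrite add0r.
have [BE|Bne] := eqVneq B 0.
  rewrite BE addr0; apply: eq_l2le xA => i.
  by have := l2le_coord i yB; rewrite BE normr_le0 => /eqP ->; rewrite addr0.
have {Ane}Ap : 0 < A by rewrite lt_def Ane.
have {Bne}Bp : 0 < B by rewrite lt_def Bne.
split=> [|J uJ]; first exact: addr_ge0.
apply: (@le_trans _ _
  (\sum_(i <- J) ((1 + B / A) * x i ^+ 2 + (1 + A / B) * y i ^+ 2))).
  apply: ler_sum => i _.
  rewrite -subr_ge0.
  have -> : (1 + B / A) * x i ^+ 2 + (1 + A / B) * y i ^+ 2 - (x i + y i) ^+ 2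
    = (B * x i - A * y i) ^+ 2 / (A * B) by field; rewrite !gt_eqF.
  by rewrite divr_ge0 ?sqr_ge0// mulr_ge0.
rewrite big_split/= -!mulr_sumr.
have -> : (A + B) ^+ 2 = (1 + B / A) * A ^+ 2 + (1 + A / B) * B ^+ 2.
  by field; rewrite !gt_eqF.
by rewrite lerD// ler_wpM2l ?(proj2 xA)// ?(proj2 yB)// addr_ge0// divr_ge0.
Qed.

Lemma l2leN x B : l2le x B -> l2le (fun i => - x i) B.
Proof. by apply: dominated_l2le => i; rewrite normrN. Qed.

Lemma l2leB x y A B : l2le x A -> l2le y B -> l2le (fun i => x i - y i) (A + B).
Proof. by move=> xA /l2leN; exact: l2leD. Qed.

Lemma l2le_reindex (f : int -> int) x B :
  injective f -> l2le x B -> l2le (fun i => x (f i)) B.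
Proof.
move=> fI [B0 xB]; split=> // J uJ.
by rewrite -(big_map f predT (fun i => x i ^+ 2)) xB// map_inj_uniq.
Qed.

Lemma l2le_shift k x B : l2le x B -> l2le (fun i => x (i + k)) B.
Proof. by apply: l2le_reindex; exact: addIr. Qed.

Lemma l2le_unit (j : int) c : l2le (fun i => if i == j then c else 0) `|c|.
Proof.
split=> // J uJ; rewrite real_normK ?num_real//.
have [jJ|jJ] := boolP (j \in J).
  rewrite (bigD1_seq j)//= eqxx big1 ?addr0// => i /negbTE ->.
  by rewrite expr0n.
rewrite big_seq big1 ?sqr_ge0// => i iJ.
by case: eqP => [ij|_]; [rewrite -ij iJ in jJ | rewrite expr0n].
Qed.

(** Fatou's lemma for l^2: a partial sum involves finitely many coordinates, so coordinatewise
    convergence suffices. *)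
Lemma l2le_lim (xn : nat -> int -> R) x B :
  (forall i, xn n i @[n --> \oo] --> x i) ->
  (forall n, l2le (xn n) B) -> l2le x B.
Proof.
move=> xnx xB; split; first exact: l2le_ge0 (xB 0%N).
move=> J uJ.
have cv : \sum_(i <- J) xn n i ^+ 2 @[n --> \oo] --> \sum_(i <- J) x i ^+ 2.
  by apply: cvg_big => // [|i _]; [exact: add_continuous|apply: cvgM; exact: xnx].
rewrite -(cvg_lim _ cv)//; apply: limr_le; first exact: cvgP cv.
by near=> n; exact: (proj2 (xB n)).
Unshelve. all: by end_near. Qed.

Lemma l2le_addgt0 x B : (forall e, 0 < e -> l2le x (B + e)) -> l2le x B.
Proof.
move=> H; have B0 : 0 <= B.
  by apply/ler_addgt0Pr => e e0; exact: l2le_ge0 (H e e0).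
split=> // J uJ.
rewrite -(ler_sqrt _ (sqr_ge0 _)) sqrtr_sqr (ger0_norm B0).
apply/ler_addgt0Pr => e e0; have [Be0 He] := H e e0.
by rewrite -(ger0_norm Be0) -sqrtr_sqr ler_wsqrtr// He.
Qed.

End SquareSummable.

(** * Derivatives, primitives and limits on the half-line, and the mean value inequality *)

Section Calculus.
Variable R : realType.
Implicit Types (f : R -> R) (a b t x l : R).

Lemma is_derive_of_expansion f x l :
  (forall e : R, 0 < e -> exists2 r : R, 0 < r &
     forall y, `|y - x| < r -> `|f y - f x - (y - x) * l| <= e * `|y - x|) ->
  is_derive x 1 f l.
Proof.
move=> H.
suff cv : h^-1 *: (f (h *: (1 : R) + x) - f x) @[h --> 0^'] --> l.
  by apply: DeriveDef; [exact: cvgP cv | exact: cvg_lim cv].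
apply/cvgrPdist_le => e e0; have [r r0 Hr] := H e e0.
near=> h.
have h0 : h != 0 by near: h; exact: nbhs_dnbhs_neq.
have hr : `|h| < r by near: h; exact: dnbhs0_lt.
have := Hr (h *: 1 + x); rewrite /GRing.scale/= mulr1 addrK => /(_ hr) le.
have -> : l - h^-1 * (f (h + x) - f x) = - h^-1 * (f (h + x) - f x - h * l).
  by field.
by rewrite normrM normrN normfV ler_pdivrMl ?normr_gt0// (mulrC `|h|).
Unshelve. all: by end_near. Qed.

Lemma deriv_ge0_le f (df : R -> R) a b : a <= b ->
  (forall x, a < x < b -> is_derive x 1 f (df x)) ->
  {within `[a, b], continuous f} ->
  (forall x, a < x < b -> 0 <= df x) -> f a <= f b.
Proof.
rewrite le_eqVlt => /predU1P[->//|ab] fdf fc df0.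
have fdf' x : x \in `]a, b[%R -> is_derive x 1 f (df x).
  by rewrite in_itv/=; exact: fdf.
have [c cab E] := MVT ab fdf' fc.
by rewrite -subr_ge0 E mulr_ge0 ?subr_ge0 ?(ltW ab)// df0.
Qed.

Lemma deriv_ge0_le_ray f (df : R -> R) a b : a <= b ->
  (forall x, a <= x -> is_derive x 1 f (df x)) ->
  (forall x, a <= x -> 0 <= df x) -> f a <= f b.
Proof.
move=> ab fdf df0; apply: (deriv_ge0_le ab (df := df)).
- by move=> x /andP[/ltW ax _]; exact: fdf.
- apply: derivable_within_continuous => x; rewrite in_itv/= => /andP[ax _].
  by have [] := fdf x ax.
- by move=> x /andP[/ltW ax _]; exact: df0.
Qed.

(** Consider the infimum of the times at which [P] fails. The first hypothesis gives [P] there and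
    the second gives it on an interval beyond, which contradicts the infimum. *)
Lemma real_induction (P : R -> Prop) :
  (forall t, 0 <= t -> (forall s, 0 <= s < t -> P s) -> P t) ->
  (forall t, 0 <= t -> (forall s, 0 <= s <= t -> P s) ->
    exists2 h : R, 0 < h & forall s, t < s < t + h -> P s) ->
  forall t, 0 <= t -> P t.
Proof.
move=> closed open t t0; apply: contrapT => nPt.
pose E := [set s : R | 0 <= s /\ ~ P s].
have E0 : E !=set0 by exists t.
have lE : lbound E 0 by move=> s [].
have hE : has_inf E by split=> //; exists 0.
have i0 : 0 <= inf E by apply: lb_le_inf.
have before s : 0 <= s < inf E -> P s.
  move=> /andP[s0 si]; apply: contrapT => nPs.
  by move: si; rewrite ltNge => /negP; apply; apply: ge_inf; [exists 0|].
have Pi : P (inf E) by exact: closed.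
have [s|h h0 Ph] := open _ i0.
  move=> /andP[s0]; rewrite le_eqVlt => /predU1P[->//|si].
  by apply: before; rewrite s0.
have [s [s0 nPs] sh] := inf_adherent h0 hE.
have : inf E <= s by apply: ge_inf; [exists 0|split].
rewrite le_eqVlt => /predU1P[E'|lt]; first by apply: nPs; rewrite -E'.
by apply/nPs/Ph; rewrite lt.
Qed.

Lemma antiderivative_exists f : continuous f ->
  exists F : R -> R, F 0 = 0 /\ forall t, 0 <= t -> is_derive t 1 F (f t).
Proof.
move=> fc.
(* The base point -1 makes 0 an interior point, so that the derivative at 0 is two-sided. *)
pose F x : R := (\int[lebesgue_measure]_(s in `[(-1)%R, x]) f s)%R.
exists (fun t => F t - F 0); split; first by rewrite subrr.
move=> t t0.
have fi : lebesgue_measure.-integrable `[(-1)%R, (t + 1)%R] (EFin \o f).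
  apply: continuous_compact_integrable; first exact: segment_compact.
  exact: continuous_subspaceT.
have t1 : t < t + 1 by rewrite ltrDl.
have t2 : -1 < t by rewrite (lt_le_trans _ t0)// ltrN10.
have [dF FE] := continuous_FTC1_closed t1 fi t2 (fc t).
have : is_derive t 1 F (f t) by split; rewrite -?FE ?derive1E.
move=> dFt; rewrite -[f t]subr0.
by apply: is_deriveB.
Qed.

(** The intervals of centre [xn n] and radius [e n] are nested, because [e n - e n.+1] is exactly
    the allowed step; the limit is the supremum of their left end points. *)
Lemma geometric_limit (xn : nat -> R) D :
  (forall n, `|xn n.+1 - xn n| <= D / 2 ^+ n) ->
  exists l : R, forall n, `|xn n - l| <= 2 * D / 2 ^+ n.
Proof.
move=> xnD.
pose e n : R := 2 * D / 2 ^+ n.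
have eS n : e n - e n.+1 = D / 2 ^+ n.
  by rewrite /e exprS; field; rewrite expf_neq0.
have low m k : xn m - e m <= xn (m + k)%N - e (m + k)%N.
  elim: k => [|k IH]; first by rewrite addn0.
  apply: le_trans IH _; rewrite addnS.
  by have := eS (m + k)%N; have := xnD (m + k)%N; rewrite ler_norml; lra.
have up m k : xn (m + k)%N + e (m + k)%N <= xn m + e m.
  elim: k => [|k IH]; first by rewrite addn0.
  apply: le_trans IH; rewrite addnS.
  by have := eS (m + k)%N; have := xnD (m + k)%N; rewrite ler_norml; lra.
have D0 : 0 <= D by have := xnD 0%N; rewrite expr0 divr1; exact: le_trans.
have e0 n : 0 <= e n by rewrite /e divr_ge0// mulr_ge0.
have cross m n : xn m - e m <= xn n + e n.
  have := low m n; have := up n m; have := e0 (m + n)%N.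
  by rewrite (addnC n m); lra.
pose S := [set xn m - e m | m in setT].
exists (sup S) => n.
have hS : has_ubound S by exists (xn n + e n) => _ [m _ <-].
rewrite ler_norml -/(e n); apply/andP; split.
  have : sup S <= xn n + e n.
    by apply: ge_sup => [|_ [m _ <-]//]; exists (xn 0%N - e 0%N); exists 0%N.
  by lra.
have : xn n - e n <= sup S by apply: ub_le_sup => //; exists n.
by lra.
Qed.

(* Cauchy-Schwarz against a vector of norm at most b, from
   2 c y <= (b/s) c^2 + (s/b) y^2. *)
Lemma sum_mul_le (J : seq int) (c y : int -> R) (s b : R) :
  0 <= s -> 0 <= b -> \sum_(i <- J) c i ^+ 2 <= s ^+ 2 ->
  \sum_(i <- J) y i ^+ 2 <= b ^+ 2 -> \sum_(i <- J) c i * y i <= s * b.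
Proof.
have zero (v w : int -> R) : \sum_(i <- J) v i ^+ 2 <= 0 ->
    \sum_(i <- J) v i * w i <= 0.
  move=> v0; have {v0} : \sum_(i <- J) v i ^+ 2 == 0.
    by rewrite eq_le v0 sumr_ge0// => i _; exact: sqr_ge0.
  rewrite psumr_eq0 => [/allP v0|i _]; last exact: sqr_ge0.
  rewrite big_seq big1// => i /v0/=; rewrite sqrf_eq0 => /eqP ->.
  by rewrite mul0r.
rewrite le_eqVlt => /predU1P[<-|s0].
  by move=> _; rewrite expr0n mul0r => c0 _; exact: zero.
rewrite le_eqVlt => /predU1P[<-|b0].
  rewrite expr0n mulr0 => _ y0; under eq_bigr do rewrite mulrC.
  exact: zero.
move=> cs yb.
apply: (@le_trans _ _
  (\sum_(i <- J) (b / s / 2 * c i ^+ 2 + s / b / 2 * y i ^+ 2))).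
  apply: ler_sum => i _; rewrite -subr_ge0.
  have -> : b / s / 2 * c i ^+ 2 + s / b / 2 * y i ^+ 2 - c i * y i =
    (b * c i - s * y i) ^+ 2 / (2 * s * b) by field; rewrite !gt_eqF.
  by rewrite divr_ge0 ?sqr_ge0// !mulr_ge0 ?ltW.
rewrite big_split/= -!mulr_sumr.
have -> : s * b = b / s / 2 * s ^+ 2 + s / b / 2 * b ^+ 2.
  by field; rewrite !gt_eqF.
by rewrite lerD// ler_wpM2l// !divr_ge0 ?ltW.
Qed.

(* Mean value inequality in l^2: project the increment on itself. *)
Lemma l2_mean_value (x dx : R -> int -> R) (b db : R -> R) (s t : R) :
  0 <= s <= t ->
  (forall (r : R) i, 0 <= r -> is_derive r 1 (x^~ i) (dx r i)) ->
  (forall r : R, 0 <= r -> is_derive r 1 b (db r)) ->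
  (forall r : R, s <= r <= t -> l2le (dx r) (db r)) ->
  l2le (fun i => x t i - x s i) (b t - b s).
Proof.
move=> /andP[s0 st] xdx bdb dxdb.
have cb : {within `[s, t], continuous b}.
  apply: derivable_within_continuous => r; rewrite in_itv/= => /andP[sr _].
  by have [] := bdb r (le_trans s0 sr).
have bst : b s <= b t.
  apply: (deriv_ge0_le st (df := db)) => // r /andP[/ltW sr /ltW rt].
    by apply: bdb; exact: le_trans sr.
  by apply: (@l2le_ge0 _ (dx r)); apply: dxdb; rewrite sr.
split=> [|J uJ]; first by rewrite subr_ge0.
set c := fun i => x t i - x s i.
pose S := \sum_(i <- J) c i ^+ 2; rewrite -/S.
have S0 : 0 <= S by rewrite sumr_ge0// => i _; exact: sqr_ge0.
pose q : R := Num.sqrt S; have q0 : 0 <= q by exact: sqrtr_ge0.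
have qS : q ^+ 2 = S by exact: sqr_sqrtr.
(* By Cauchy-Schwarz [phi] is nondecreasing on [[s, t]]; comparing its end values gives
   [q ^+ 2 <= q * (b t - b s)]. *)
pose phi (r : R) : R := q * b r - \sum_(i <- J) c i * x r i.
pose dphi (r : R) : R := q * db r - \sum_(i <- J) c i * dx r i.
have dP (r : R) : 0 <= r -> is_derive r 1 phi (dphi r).
  move=> r0; have := bdb r r0 => bdbr.
  apply: is_deriveB.
  rewrite [X in is_derive _ _ X _](_ : _ =
    \sum_(j < size J) (fun v => c (J`_j) * x v (J`_j))); last first.
    by apply/funext => v; rewrite fct_sumE (big_nth 0) big_mkord.
  rewrite (big_nth 0) big_mkord; apply: is_derive_sum => j.
  have := xdx r (J`_j) r0 => ?.
  exact: is_deriveZ.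
have : phi s <= phi t.
  apply: (deriv_ge0_le st (df := dphi))
    => [r /andP[/ltW sr _]||r /andP[/ltW sr /ltW rt]].
  - by apply: dP; exact: le_trans sr.
  - apply: derivable_within_continuous => r; rewrite in_itv/= => /andP[sr _].
    by have [] := dP r (le_trans s0 sr).
  - have [|db0 dxr] := dxdb r; first by rewrite sr rt.
    by rewrite subr_ge0; apply: sum_mul_le => //; [rewrite qS|exact: dxr].
rewrite /phi => le.
have {le} : S <= q * (b t - b s).
  have -> : S = \sum_(i <- J) c i * x t i - \sum_(i <- J) c i * x s i.
    by rewrite -sumrB; apply: eq_bigr => i _; rewrite -mulrBr expr2.
  by rewrite mulrBr; lra.
rewrite -qS; have [->|qn0] := eqVneq q 0; first by rewrite expr0n sqr_ge0.
rewrite expr2 ler_pM2l ?lt_def ?qn0// => qb.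
by rewrite -expr2 lerXn2r// nnegrE// subr_ge0.
Qed.

End Calculus.

(** * Global existence for a Lipschitz field on l^2 *)

Section Picard.
Variable R : realType.

Lemma geometric_cvg0 (D : R) : D / 2 ^+ n @[n --> \oo] --> (0 : R).
Proof.
rewrite -(mulr0 D); apply: cvgMr.
under eq_fun do rewrite -exprVn.
by apply: cvg_expr; rewrite ger0_norm ?invr_ge0// invf_lt1// ltr1n.
Qed.

Lemma geometric_squeeze0 (z D : R) : (forall n, `|z| <= D / 2 ^+ n) -> z = 0.
Proof.
move=> zD; apply/eqP; rewrite -normr_le0.
have cv := geometric_cvg0 D.
rewrite -(cvg_lim _ cv)//; apply: limr_ge; first exact: cvgP cv.
by near=> n; exact: zD.
Unshelve. all: by end_near. Qed.

Lemma geometric_cvg (xn : nat -> R) (l D : R) :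
  (forall n, `|xn n - l| <= D / 2 ^+ n) -> xn n @[n --> \oo] --> l.
Proof.
move=> xnD.
have cv := geometric_cvg0 D.
apply/cvgrPdist_lt => e e0.
near=> n.
rewrite distrC; apply: le_lt_trans (xnD n) _.
near: n; have /cvgrPdist_lt/(_ e e0) := cv.
apply: filterS => n; rewrite sub0r normrN; exact/le_lt_trans/ler_norm.
Unshelve. all: by end_near. Qed.

Variables (F : (int -> R) -> int -> R) (C A : R) (psi0 : int -> R).
Hypothesis C_gt0 : 0 < C.
Hypothesis F_bound : forall x B, l2le x B -> l2le (F x) (C * B).
Hypothesis F_lip : forall x y B, l2le (fun i => x i - y i) B ->
  l2le (fun i => F x i - F y i) (C * B).
Hypothesis psi0A : l2le psi0 A.

(* Every Picard iterate moves at most as much as this majorant, because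
   [b' = 2 C b] dominates the Lipschitz bound [C b] of the field. *)
Let b (t : R) : R := A * expR (2 * C * t).

Let db (t : R) : is_derive t 1 b (2 * C * b t).
Proof.
have h : is_derive t 1 (fun t : R => 2 * C * t) (2 * C).
  by rewrite -[X in is_derive _ _ _ X]mulr1; exact: is_deriveZ.
have e : is_derive t 1 (fun t => expR (2 * C * t)) (expR (2 * C * t) * (2 * C)).
  exact: is_derive1_comp.
have -> : 2 * C * b t = A * (expR (2 * C * t) * (2 * C)) by rewrite /b; ring.
exact: is_deriveZ.
Qed.

Let b_ge0 t : 0 <= b t.
Proof. by rewrite mulr_ge0 ?expR_ge0// (l2le_ge0 psi0A). Qed.

Let b_le s t : s <= t -> b s <= b t.
Proof.
move=> st; rewrite ler_wpM2l ?(l2le_ge0 psi0A)// ler_expR ler_pM2l//.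
by rewrite mulr_gt0.
Qed.

Let b0 : b 0 = A. Proof. by rewrite /b mulr0 expR0 mulr1. Qed.

(** The class preserved by the Picard map. The bound on increments yields both continuity in time
    with values in l^2 and the norm bound [b t]. *)
Definition majorized (X : R -> int -> R) : Prop :=
  X 0 = psi0 /\ forall s t, 0 <= s <= t ->
    l2le (fun i => X t i - X s i) (b t - b s).

Lemma majorized_dist X s t : majorized X -> 0 <= s -> 0 <= t ->
  l2le (fun i => X t i - X s i) `|b t - b s|.
Proof.
move=> [_ mX] s0 t0; have [st|/ltW ts] := leP s t.
  by rewrite ger0_norm ?subr_ge0 ?b_le//; apply: mX; rewrite s0.
rewrite distrC ger0_norm ?subr_ge0 ?b_le//.
have := mX t s; rewrite t0 ts => /(_ isT)/l2leN.
by apply: eq_l2le => i; rewrite opprB.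
Qed.

Lemma majorized_norm X t : majorized X -> 0 <= t -> l2le (X t) (b t).
Proof.
move=> [X0 mX] t0.
have := mX 0 t; rewrite lexx t0 => /(_ isT) m.
have := l2leD m psi0A; rewrite b0 subrK; apply: eq_l2le => i.
by rewrite X0 subrK.
Qed.

Lemma picard_step X : majorized X -> exists Y, majorized Y /\
  forall (t : R) i, 0 <= t -> is_derive t 1 (Y^~ i) (F (X t) i).
Proof.
move=> mX.
(* Freezing [X] before time 0 makes the integrand continuous on the whole line, as
   [antiderivative_exists] requires. *)
have cX i : continuous (fun t : R => F (X (Num.max t 0)) i).
  move=> t; apply/cvgrPdist_lt => e e0.
  have cb : {for t, continuous (fun t : R => C * b (Num.max t 0))}.
    apply: cvgMr.
    apply: (@continuous_comp _ _ _ (fun t : R => Num.max t 0 : R) b).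
      by apply: (@continuous_max _ _ id (cst 0) t); [exact: cvg_id|exact: cvg_cst].
    by apply/differentiable_continuous/derivable1_diffP; have [] := db (Num.max t 0).
  have /cvgrPdist_lt/(_ e e0) := cb.
  apply: filterS => r; apply: le_lt_trans.
  rewrite -mulrBr normrM (gtr0_norm C_gt0).
  have m0 (v : R) : 0 <= Num.max v 0 by rewrite le_max lexx orbT.
  have /F_lip/(l2le_coord i) := majorized_dist mX (m0 r) (m0 t).
  by [].
have [P HP] := choice (fun i => antiderivative_exists (cX i)).
pose Y t i := psi0 i + P i t.
have dY (t : R) i : 0 <= t -> is_derive t 1 (Y^~ i) (F (X t) i).
  move=> t0; have [_ /(_ t t0)] := HP i.
  rewrite max_l// => dP.
  rewrite -[F _ _]add0r; exact: is_deriveD.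
exists Y; split=> //; split.
  by apply/funext => i; rewrite /Y (HP i).1 addr0.
move=> s t st; apply: (l2_mean_value st dY (fun r _ => db r)) => r /andP[sr rt].
have r0 : 0 <= r by case/andP: st => s0 _; exact: le_trans sr.
apply: le_l2le (F_bound (majorized_norm mX r0)).
by rewrite -mulrA ler_peMl ?ler1n// mulr_ge0// ltW.
Qed.

Theorem picard_lindelof : exists X : R -> int -> R,
  [/\ X 0 = psi0,
      forall (t : R) i, 0 <= t -> is_derive t 1 (X^~ i) (F (X t) i) &
      forall s t, 0 <= s -> 0 <= t ->
        l2le (fun i => X t i - X s i)
          `|A * expR (2 * C * t) - A * expR (2 * C * s)|].
Proof.
have stepT (X : {X | majorized X}) : exists Y : {Y | majorized Y},
    forall (t : R) i, 0 <= t -> is_derive t 1 ((sval Y)^~ i) (F (sval X t) i).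
  by have [Y [mY dY]] := picard_step (svalP X); exists (exist _ Y mY).
have [T dT] := choice stepT.
have m0 : majorized (fun=> psi0).
  split=> // s t /andP[_ st]; apply: (@le_l2le _ _ 0).
    by rewrite subr_ge0 b_le.
  by apply: eq_l2le (l2le0 R) => i; rewrite subrr.
pose X n := sval (iter n T (exist _ _ m0)).
have mX n : majorized (X n) := svalP _.
have dX n (t : R) i : 0 <= t -> is_derive t 1 ((X n.+1)^~ i) (F (X n t) i).
  exact: dT.
have dbn n (t : R) : is_derive t 1 (fun t => b t / 2 ^+ n) (2 * C * b t / 2 ^+ n).
  have := db t => dbt.
  have := is_deriveZ (2 ^+ n)^-1 dbt.
  rewrite /GRing.scale/= mulrC => h.
  rewrite [X in is_derive _ _ X _](_ : _ = (2 ^+ n)^-1 *: b)//.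
  by apply/funext => v; rewrite mulrC.
(* Here the factor 2 in the exponent of [b] pays off: [C * (b / 2 ^+ n)] is the derivative of
   [b / 2 ^+ n.+1], so each iteration halves the gap on all of the half-line, without restricting to
   short times. *)
have XS n t : 0 <= t -> l2le (fun i => X n.+1 t i - X n t i) (b t / 2 ^+ n).
  elim: n t => [|n IH] t t0.
    have [X10 /(_ 0 t)] := mX 1%N; rewrite lexx t0 => /(_ isT).
    rewrite X10 expr0 divr1; apply: le_l2le; by rewrite gerBl.
  have tt : 0 <= (0 : R) <= t by rewrite lexx.
  have dd (r : R) i : 0 <= r ->
      is_derive r 1 (fun r => X n.+2 r i - X n.+1 r i) (F (X n.+1 r) i - F (X n r) i).
    move=> r0; have := dX n.+1 r i r0; have := dX n r i r0 => d1 d2.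
    exact: is_deriveB.
  have := l2_mean_value (x := fun r i => X n.+2 r i - X n.+1 r i) tt dd
    (fun r _ => dbn n.+1 r).
  move=> H; apply: (@le_l2le _ _ (b t / 2 ^+ n.+1 - b 0 / 2 ^+ n.+1)).
    by rewrite gerBl divr_ge0// exprn_ge0.
  apply: eq_l2le (H _) => [i|r /andP[r0 _]].
    by rewrite (mX n.+2).1 (mX n.+1).1 subrr subr0.
  apply: le_l2le (F_lip (IH r r0)).
  rewrite le_eqVlt; apply/orP; left; apply/eqP.
  by rewrite exprS; field; rewrite expf_neq0.
have XnX n m t : 0 <= t -> l2le (fun i => X n t i - X (n + m)%N t i)
    (2 * b t / 2 ^+ n - 2 * b t / 2 ^+ (n + m)).
  move=> t0; elim: m => [|m IH].
    rewrite addn0 subrr; by apply: eq_l2le (l2le0 R) => i; rewrite subrr.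
  have E : 2 * b t / 2 ^+ n - 2 * b t / 2 ^+ (n + m) + b t / 2 ^+ (n + m) =
           2 * b t / 2 ^+ n - 2 * b t / 2 ^+ (n + m).+1.
    by rewrite (exprS _ (n + m)); field; rewrite !expf_neq0.
  rewrite addnS -E; apply: eq_l2le (l2leB IH (XS (n + m)%N t t0)) => i.
  by ring.
have limX (p : R * int) : exists l, 0 <= p.1 ->
    forall n, `|X n p.1 p.2 - l| <= 2 * b p.1 / 2 ^+ n.
  have [p0|p0] := leP 0 p.1; last by exists 0.
  have [l Hl] := geometric_limit (fun n => l2le_coord p.2 (XS n p.1 p0)).
  by exists l.
have [Z0 HZ0] := choice limX.
pose Z t i := Z0 (t, i).
have HZ t i n : 0 <= t -> `|X n t i - Z t i| <= 2 * b t / 2 ^+ n.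
  by move=> t0; exact: (HZ0 (t, i) t0).
have cZ t i : 0 <= t -> X n t i @[n --> \oo] --> Z t i.
  by move=> t0; apply: geometric_cvg => n; exact: HZ.
have mZ : majorized Z.
  split.
    apply/funext => i; apply/eqP; rewrite -subr_eq0; apply/eqP.
    apply: (@geometric_squeeze0 _ (2 * b 0)) => n.
    by rewrite distrC -{1}(mX n).1; apply: HZ.
  move=> s t /andP[s0 st].
  apply: (@l2le_lim _ (fun n i => X n t i - X n s i)) => [i|n].
    by apply: cvgB; apply: cZ => //; exact: le_trans st.
  by apply: (mX n).2; rewrite s0.
have XZ n t : 0 <= t -> l2le (fun i => X n t i - Z t i) (2 * b t / 2 ^+ n).
  move=> t0; apply: (@l2le_lim _ (fun m i => X n t i - X (n + m)%N t i)) => [i|m].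
    apply: cvgB; first exact: cvg_cst.
    have := cZ t i t0; rewrite -(cvg_shiftn n); under eq_fun do rewrite addnC.
    by [].
  apply: le_l2le (XnX n m t t0); rewrite gerBl divr_ge0 ?exprn_ge0//.
  by rewrite mulr_ge0.
(* The limit [Z] is not differentiated, and its values at negative times are arbitrary. One more
   Picard step gives a differentiable [Y], which agrees with [Z] for nonnegative times because both
   are geometrically close to the iterates. *)
have [Y [mY dY]] := picard_step mZ.
have XY n t : 0 <= t -> l2le (fun i => X n.+1 t i - Y t i) (b t / 2 ^+ n).
  move=> t0; have tt : 0 <= (0 : R) <= t by rewrite lexx.
  have dd (r : R) i : 0 <= r ->
      is_derive r 1 (fun r => X n.+1 r i - Y r i) (F (X n r) i - F (Z r) i).
    move=> r0; have := dX n r i r0; have := dY r i r0 => d1 d2.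
    exact: is_deriveB.
  have := l2_mean_value (x := fun r i => X n.+1 r i - Y r i) tt dd
    (fun r _ => dbn n r).
  move=> H; apply: (@le_l2le _ _ (b t / 2 ^+ n - b 0 / 2 ^+ n)).
    by rewrite gerBl divr_ge0// exprn_ge0.
  apply: eq_l2le (H _) => [i|r /andP[r0 _]].
    by rewrite (mX n.+1).1 mY.1 subrr subr0.
  apply: le_l2le (F_lip (XZ n r r0)).
  by rewrite !mulrA (mulrC C).
have YZ t : 0 <= t -> Y t = Z t.
  move=> t0; apply/funext => i; apply/eqP; rewrite -subr_eq0; apply/eqP.
  apply: (@geometric_squeeze0 _ (2 * b t)) => n.
  have -> : 2 * b t / 2 ^+ n = b t / 2 ^+ n + 2 * b t / 2 ^+ n.+1.
    by rewrite exprS; field; rewrite expf_neq0.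
  have -> : Y t i - Z t i = - (X n.+1 t i - Y t i) + (X n.+1 t i - Z t i).
    by ring.
  apply: le_trans (ler_normD _ _) _; rewrite normrN lerD ?HZ//.
  exact: l2le_coord (XY n t t0).
exists Y; split.
- exact: mY.1.
- by move=> t i t0; rewrite YZ//; exact: dY.
- by move=> s t s0 t0; exact: majorized_dist.
Qed.

End Picard.

(** * Exponential decay for fields whose Euler steps contract *)

Section Decay.
Variable R : realType.
Implicit Types (F : (int -> R) -> int -> R) (psi : R -> int -> R).

Lemma cvg_within_dnbhsP (f : R -> R) (D : set R) (t l : R) :
  (f y @[y --> within D t^'] --> l) <->
  (forall e : R, 0 < e -> exists2 r : R, 0 < r &
     forall y, D y -> y != t -> `|y - t| < r -> `|f y - l| <= e).
Proof.
split=> [cv e e0|H].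
  have /cvgrPdist_le/(_ e e0) := cv.
  move=> /nbhs_ballP[r /= r0 Hr]; exists r => // y Dy yt ytr.
  rewrite distrC; apply: Hr => //.
  by rewrite /ball/= distrC.
apply/cvgrPdist_le => e e0; have [r r0 Hr] := H e e0.
apply/nbhs_ballP; exists r => //= y; rewrite /ball/= distrC => ytr yt Dy.
by rewrite distrC; exact: Hr.
Qed.

(** Differentiability in l^2 along the solution, one-sided at 0, written without a quotient so that
    [t' = t] is no exception and [l2le] applies. *)
Definition l2_expansion F psi : Prop :=
  forall t : R, 0 <= t -> forall e : R, 0 < e -> exists2 r : R, 0 < r &
    forall t' : R, 0 <= t' -> `|t' - t| < r ->
      l2le (fun i => psi t' i - psi t i - (t' - t) * F (psi t) i) (e * `|t' - t|).

Lemma classical_solution_expansion (d : R) g u (psi0 : int -> R) psi :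
  classical_solution d g u psi0 psi ->
  l2_expansion (perturbation_field d g u) psi.
Proof.
move=> [_ psi2 F2 dpsi _] t t0 e e0.
set F := perturbation_field d g u in F2 dpsi *.
have /cvg_within_dnbhsP/(_ e e0)[r r0 Hr] := dpsi t t0.
exists r => // t' t'0 t'r.
have [->|t't] := eqVneq t' t.
  rewrite subrr normr0 mulr0; apply: eq_l2le (l2le0 R) => i.
  by rewrite subrr mul0r subrr.
have tt0 : t' - t != 0 by rewrite subr_eq0.
set q := fun i => (psi t' i - psi t i) / (t' - t) - F (psi t) i.
(* A small [l2norm] says nothing before membership is known: the norm of a sequence outside l^2
   evaluates to 0. *)
have : in_l2 q.
  have h1 := l2leB (in_l2_l2le (psi2 t' t'0)) (in_l2_l2le (psi2 t t0)).
  have := l2leB (l2leZ (t' - t)^-1 h1) (in_l2_l2le (F2 t t0)).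
  move=> /l2le_in_l2[+ _]; congr in_l2.
  by apply/funext => i; rewrite /q mulrC.
have := Hr t'; rewrite /= in_itv/= t'0 => /(_ isT t't t'r).
rewrite subr0 => qe /in_l2_l2le q2.
have : l2le q e by apply: le_l2le q2; exact: le_trans (ler_norm _) qe.
move=> /(l2leZ (t' - t)); rewrite mulrC; apply: eq_l2le => i.
by rewrite /q; field.
Qed.

Lemma expansion_classical_solution (d : R) g u (psi0 : int -> R) psi :
  let F := perturbation_field d g u in
  psi 0 = psi0 ->
  (forall t, 0 <= t -> exists B, l2le (psi t) B) ->
  (forall t, 0 <= t -> exists B, l2le (F (psi t)) B) ->
  l2_expansion F psi ->
  (forall t : R, 0 <= t -> forall e : R, 0 < e -> exists2 r : R, 0 < r &
    forall t' : R, 0 <= t' -> `|t' - t| < r ->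
      l2le (fun i => F (psi t') i - F (psi t) i) e) ->
  classical_solution d g u psi0 psi.
Proof.
move=> F psi0E psi2 F2 dpsi cF; split => //.
- by move=> t /psi2[B /l2le_in_l2[]].
- by move=> t /F2[B /l2le_in_l2[]].
- move=> t t0; apply/cvg_within_dnbhsP => e e0.
  have [r r0 Hr] := dpsi t t0 e e0; exists r => // t' /=.
  rewrite in_itv/= andbT => t'0 t't t'r.
  have tt0 : t' - t != 0 by rewrite subr_eq0.
  have /(l2leZ (t' - t)^-1) := Hr t' t'0 t'r.
  rewrite normfV mulrC mulfK ?normr_eq0// => h.
  rewrite subr0 ger0_norm ?sqrtr_ge0//.
  apply: (l2le_in_l2 _).2; apply: eq_l2le h => i.
  by rewrite /F; field.
- move=> t t0; apply/cvgrPdist_le => e e0.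
  have [r r0 Hr] := cF t t0 e e0.
  apply/nbhs_ballP; exists r => //= t'; rewrite /ball/= distrC => t'r.
  rewrite in_itv/= andbT => t'0.
  rewrite sub0r normrN ger0_norm ?sqrtr_ge0//.
  exact: (l2le_in_l2 (Hr t' t'0 t'r)).2.
Qed.

(* The hypothesis says that the logarithmic norm of F is at most -k on the
   ball of radius rho. *)
Lemma exponential_decay F psi (k rho h0 B0 : R) : 0 < k -> 0 < h0 ->
  (forall x B h, l2le x B -> B <= rho -> 0 <= h <= h0 ->
     l2le (fun i => x i + h * F x i) ((1 - k * h) * B)) ->
  (forall t, 0 <= t -> exists B, l2le (F (psi t)) B) ->
  l2_expansion F psi -> 0 < B0 -> B0 <= rho -> l2le (psi 0) B0 ->
  forall t, 0 <= t -> l2le (psi t) (B0 * expR (- (k / 2) * t)).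
Proof.
move=> k0 h00 contr F2 dpsi B00 B0rho psi0B0.
pose beta (t : R) : R := B0 * expR (- (k / 2) * t).
have beta0 t : 0 < beta t by rewrite mulr_gt0 ?expR_gt0.
have betarho t : 0 <= t -> beta t <= rho.
  move=> t0; apply: le_trans B0rho; rewrite /beta.
  rewrite ler_piMr ?(ltW B00)// -[leRHS]expR0 ler_expR.
  by rewrite mulNr oppr_le0 mulr_ge0// ltW// divr_gt0.
apply: real_induction => t t0 IH.
- move: t0; rewrite le_eqVlt => /predU1P[<-|t0]; first by rewrite mulr0 expR0 mulr1.
  apply: l2le_addgt0 => e e0; rewrite -/(beta t).
  have [BF HBF] := F2 t (ltW t0).
  have BF0 := l2le_ge0 HBF.
  have [r r0 Hr] := dpsi t (ltW t0) 1 ltr01.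
  have cb : {for t, continuous (fun s : R => beta s + `|s - t| * (1 + BF))}.
    apply: cvgD.
      apply: cvgMr; apply: continuous_comp; last exact: continuous_expR.
      by apply: cvgMr; exact: cvg_id.
    apply: cvgMl; apply: cvg_norm; apply: cvgB; [exact: cvg_id|exact: cvg_cst].
  have /cvgrPdist_lt/(_ e e0) := cb.
  rewrite subrr normr0 mul0r addr0 => /nbhs_ballP[r1 /= r10 Hr1].
  pose m := Num.min (Num.min r r1) t.
  have m0 : 0 < m by rewrite !lt_min r0 r10 t0.
  have [mr mr1 mt] : [/\ m <= r, m <= r1 & m <= t].
    by rewrite /m; split; rewrite ge_min ?lexx ?orbT// ge_min lexx ?orbT.
  pose s := t - m / 2.
  have st : s - t = - (m / 2) by rewrite /s; ring.
  have ast : `|s - t| = m / 2 by rewrite st normrN ger0_norm// divr_ge0// ltW.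
  have s0 : 0 <= s by rewrite /s; lra.
  have lst : s < t by rewrite /s; lra.
  have Hs : l2le (psi s) (beta s) by apply: IH; rewrite s0.
  have sr : `|s - t| < r by rewrite ast; lra.
  have rem := Hr s s0 sr.
  have := l2leB (l2leB Hs rem) (l2leZ (s - t) HBF).
  have := Hr1 s; rewrite /ball/= (distrC t) ast => /(_ ltac:(lra)).
  rewrite ltr_norml => /andP[lo _] h.
  apply: le_l2le (eq_l2le _ h) => [|i]; last by ring.
  by rewrite -!ast in lo *; lra.
- have HB : l2le (psi t) (beta t) by apply: IH; rewrite t0 lexx.
  (* Half of the rate pays for the remainder: with [h = s - t],
     [(1 - k * h) + k / 2 * h = 1 - k / 2 * h], which is at most [expR (- (k / 2) * h)]. *)
  have [r r0 Hr] := dpsi t t0 (k / 2 * beta t) ltac:(by rewrite mulr_gt0// divr_gt0).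
  exists (Num.min r h0); first by rewrite lt_min r0.
  move=> s /andP[ts sr].
  have hs : 0 < s - t by rewrite subr_gt0.
  have [sr' sh] : s - t < r /\ s - t < h0.
    by move: sr; rewrite addrC -ltrBlDr lt_min => /andP[].
  have s0 : 0 <= s by rewrite (le_trans t0)// ltW.
  have := Hr s s0; rewrite (gtr0_norm hs) => /(_ sr') rem.
  have := contr _ _ (s - t) HB (betarho t t0); rewrite (ltW hs) (ltW sh) => /(_ isT) h.
  rewrite -/(beta s); apply: le_l2le (eq_l2le _ (l2leD h rem)) => [|i]; last by ring.
  have -> : beta s = beta t * expR (- (k / 2) * (s - t)).
    by rewrite /beta -mulrA -expRD; congr (_ * expR _); ring.
  have := expR_ge1Dx (- (k / 2) * (s - t)).
  by rewrite -(ler_pM2l (beta0 t)); lra.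
Qed.

End Decay.

(** * Asymptotic stability from slopes below a negative constant *)

Section LatticeStability.
Variable R : realType.
Implicit Types (x y : int -> R) (phi : int -> R -> R).

(** An arbitrary nonlinearity at each site, so that the original and the clamped field are treated
    alike. *)
Definition lattice_field (d : R) phi x (i : int) : R :=
  d * (x (i - 1) - 2 * x i + x (i + 1)) + phi i (x i).

Lemma perturbation_fieldE (d : R) g u :
  perturbation_field d g u = lattice_field d (fun i v => g (u i + v) - g (u i)).
Proof. by apply/funext => x; apply/funext => i; rewrite /perturbation_field -addrA. Qed.

Lemma lattice_field_lip (d K : R) phi : 0 <= d -> 0 <= K ->
  (forall i v w, `|phi i v - phi i w| <= K * `|v - w|) ->
  forall x y B, l2le (fun i => x i - y i) B ->
  l2le (fun i => lattice_field d phi x i - lattice_field d phi y i) ((4 * d + K) * B).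
Proof.
move=> d0 K0 lip x y B xy.
have h1 := l2leZ d (l2le_shift (-1) xy).
have h2 := l2leZ d (l2le_shift 1 xy).
have h3 := l2leZ (-2 * d) xy.
have h4 : l2le (fun i => phi i (x i) - phi i (y i)) (K * B).
  have := l2leZ K xy; rewrite ger0_norm//; apply: dominated_l2le => i.
  by rewrite normrM (ger0_norm K0).
have := l2leD (l2leD (l2leD h1 h2) h3) h4.
rewrite normrM normrN (ger0_norm d0) ger0_norm// => h.
rewrite (_ : _ * B = d * B + d * B + 2 * d * B + K * B); last by ring.
by apply: eq_l2le h => i; rewrite /lattice_field; ring.
Qed.

(** In [x + h * F x] the diagonal factor is [1 - 2 * d * h + h * c]. The bound on [h] keeps it
    nonnegative for [c >= - K], hence of size at most [1 - 2 * d * h - k * h]; the two shifts add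
    [2 * d * h]. *)
Lemma lattice_field_contraction (d K k rho : R) phi : 0 < d -> 0 < k ->
  (forall i v, `|v| <= rho -> exists2 c, - K <= c <= - k & phi i v = c * v) ->
  forall x B h, l2le x B -> B <= rho -> 0 <= h <= (2 * d + K)^-1 ->
  l2le (fun i => x i + h * lattice_field d phi x i) ((1 - k * h) * B).
Proof.
move=> d0 k0 slope x B h xB Brho /andP[h0 hK].
have B0 := l2le_ge0 xB.
have kK : k <= K.
  have [|c] := slope 0 0; first by rewrite normr0 (le_trans B0).
  by lra.
have hK1 : h * (2 * d + K) <= 1.
  by move: hK; rewrite -[_^-1]mul1r ler_pdivlMr//; lra.
have hk : h * k <= h * K by exact: ler_wpM2l.
have f0 : 0 <= 1 - 2 * d * h - k * h by lra.
have h1 := l2leZ (h * d) (l2le_shift (-1) xB).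
have h2 := l2leZ (h * d) (l2le_shift 1 xB).
have h3 : l2le (fun i => (1 - 2 * d * h) * x i + h * phi i (x i))
    ((1 - 2 * d * h - k * h) * B).
  have := l2leZ (1 - 2 * d * h - k * h) xB; rewrite (ger0_norm f0).
  apply: dominated_l2le => i.
  have [|c /andP[Kc ck] ->] := slope i (x i).
    by apply: le_trans Brho; exact: l2le_coord.
  rewrite [X in `|X|](_ : _ = (1 - 2 * d * h + h * c) * x i); last by ring.
  rewrite !normrM ler_wpM2r// (ger0_norm f0).
  have := ler_wpM2l h0 Kc; have := ler_wpM2l h0 ck => ck' Kc'.
  by rewrite ger0_norm; lra.
have := l2leD (l2leD h1 h2) h3.
rewrite normrM (ger0_norm h0) (gtr0_norm d0) => H.
rewrite (_ : _ * B = h * d * B + h * d * B + (1 - 2 * d * h - k * h) * B); last by ring.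
by apply: eq_l2le H => i; rewrite /lattice_field; ring.
Qed.

Definition clamp (rho v : R) : R := Num.max (- rho) (Num.min v rho).

Lemma clamp_id rho v : `|v| <= rho -> clamp rho v = v.
Proof. by rewrite ler_norml /clamp => /andP[lo hi]; rewrite min_l// max_r. Qed.

Lemma clamp_le rho v : 0 <= rho -> `|clamp rho v| <= rho.
Proof.
move=> r0; rewrite ler_norml /clamp le_max lexx/= ge_max ge_min lexx orbT andbT.
by rewrite (le_trans _ r0)// oppr_le0.
Qed.

Lemma clamp_lip rho v w : 0 <= rho -> `|clamp rho v - clamp rho w| <= `|v - w|.
Proof.
move=> r0; rewrite /clamp /Num.max /Num.min.
by repeat case: ifPn; rewrite -?leNgt => *; rewrite ler_norml; apply/andP; split;
  have := ler_norm (v - w); have := ler_norm (w - v); rewrite (distrC w); lra.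
Qed.

(** Clamping makes the field globally Lipschitz without changing it in the ball of radius [rho];
    decay for the clamped field keeps the solution in that ball, where it solves the original
    equation. *)
Lemma lattice_solution_exists (d K k rho B0 : R) phi (psi0 : int -> R) :
  0 < d -> 0 < k -> 0 < B0 -> B0 <= rho -> l2le psi0 B0 ->
  (forall i, phi i 0 = 0) ->
  (forall i v w, `|v| <= rho -> `|w| <= rho ->
     exists2 c, - K <= c <= - k & phi i v - phi i w = c * (v - w)) ->
  let F := lattice_field d phi in
  exists psi : R -> int -> R,
  [/\ psi 0 = psi0, forall t, 0 <= t -> l2le (psi t) rho,
      forall t, 0 <= t -> exists B, l2le (F (psi t)) B,
      l2_expansion F psi
    & forall t : R, 0 <= t -> forall e : R, 0 < e -> exists2 r : R, 0 < r &
      forall t' : R, 0 <= t' -> `|t' - t| < r ->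
        l2le (fun i => F (psi t') i - F (psi t) i) e].
Proof.
move=> d0 k0 B00 B0rho psi0B0 phi0 slope F.
have rho0 : 0 < rho by exact: lt_le_trans B0rho.
have kK : k <= K.
  by have [||c] := slope 0 0 0; rewrite ?normr0 ?(ltW rho0)//; lra.
have K0 : 0 < K by exact: lt_le_trans kK.
pose tphi i v := phi i (clamp rho v).
pose G := lattice_field d tphi.
pose C := 4 * d + K.
have C0 : 0 < C by rewrite /C; lra.
have tlip i v w : `|tphi i v - tphi i w| <= K * `|v - w|.
  have [||c /andP[Kc ck] E] := slope i (clamp rho v) (clamp rho w).
  - exact/clamp_le/ltW.
  - exact/clamp_le/ltW.
  rewrite /tphi E normrM; apply: ler_pM => //; last exact/clamp_lip/ltW.
  by rewrite ler_norml; lra.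
have Glip : forall x y B, l2le (fun i => x i - y i) B ->
    l2le (fun i => G x i - G y i) (C * B).
  exact: lattice_field_lip (ltW d0) (ltW K0) tlip.
have Gbound x B : l2le x B -> l2le (G x) (C * B).
  move=> xB.
  have : l2le (fun i => x i - (fun=> 0) i) B by apply: eq_l2le xB => i; rewrite subr0.
  move=> /Glip; apply: eq_l2le => i.
  rewrite [X in _ - X](_ : _ = 0) ?subr0// /G /lattice_field /tphi.
  rewrite clamp_id ?phi0 ?normr0 ?(ltW rho0)//.
  by ring.
have [X [X0 dX mX]] := picard_lindelof C0 Gbound Glip psi0B0.
pose b (t : R) : R := B0 * expR (2 * C * t).
have b_le s t : s <= t -> b s <= b t.
  by move=> st; rewrite ler_wpM2l ?(ltW B00)// ler_expR ler_pM2l// mulr_gt0.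
have cb (t : R) : {for t, continuous b}.
  apply: cvgMr; apply: continuous_comp; last exact: continuous_expR.
  by apply: cvgMr; exact: cvg_id.
have small (t e : R) : 0 < e -> exists2 r : R, 0 < r &
    forall t' : R, `|t' - t| < r -> C * `|b t' - b t| <= e.
  move=> e0; have eC : 0 < e / C by rewrite divr_gt0.
  have /cvgrPdist_le/(_ _ eC)/nbhs_ballP[r /= r0 Hr] := cb t.
  exists r => // t' t'r; rewrite mulrC -ler_pdivlMr// distrC.
  by apply: Hr; rewrite /ball/= distrC.
have GX s t : 0 <= s -> 0 <= t ->
    l2le (fun i => G (X t) i - G (X s) i) (C * `|b t - b s|).
  by move=> s0 t0; apply: Glip; exact: mX.
(* Coordinatewise derivatives are not uniform in the site. Applying the mean value inequality to
   [X v - v * G (X t)], with majorant [e * v], upgrades them to an expansion in l^2. *)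
have expX : l2_expansion G X.
  move=> t t0 e e0; have [r r0 Hr] := small t e e0; exists r => // t' t'0 t'r.
  have dd (v : R) i : 0 <= v ->
      is_derive v 1 (fun v => X v i - v * G (X t) i) (G (X v) i - G (X t) i).
    move=> v0; have := dX v i v0 => dXv.
    apply: is_deriveB.
    have -> : (fun v => v * G (X t) i) = G (X t) i *: (id : R -> R).
      by apply/funext => z; rewrite mulrC.
    by rewrite -[X in is_derive _ _ _ X]mulr1; exact: is_deriveZ.
  have de (v : R) : 0 <= v -> is_derive v 1 (fun v : R => e * v) e.
    by move=> _; rewrite -[X in is_derive _ _ _ X]mulr1; exact: is_deriveZ.
  have [tt'|/ltW t't] := leP t t'.
    have I : 0 <= t <= t' by rewrite t0.
    have := l2_mean_value I dd de.
    rewrite ger0_norm ?subr_ge0// -mulrBr => H; apply: eq_l2le (H _) => [i|v /andP[tv vt]].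
      by ring.
    apply: le_l2le (GX t v t0 (le_trans t0 tv)).
    apply: Hr; rewrite ger0_norm ?subr_ge0//.
    by apply: le_lt_trans t'r; rewrite ger0_norm ?subr_ge0// lerB.
  have I : 0 <= t' <= t by rewrite t'0.
  have := l2_mean_value I dd de.
  rewrite distrC ger0_norm ?subr_ge0// -mulrBr => H.
  apply: eq_l2le (l2leN (H _)) => [i|v /andP[tv vt]]; first by ring.
  apply: le_l2le (GX t v t0 (le_trans t'0 tv)).
  apply: Hr; rewrite distrC ger0_norm ?subr_ge0//.
  by apply: le_lt_trans t'r; rewrite distrC ger0_norm ?subr_ge0// lerB.
have tslope i v : `|v| <= rho -> exists2 c, - K <= c <= - k & tphi i v = c * v.
  move=> vr; have [||c cI E] := slope i v 0; rewrite ?normr0 ?(ltW rho0)//.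
  by exists c => //; rewrite /tphi clamp_id//; move: E; rewrite phi0 !subr0.
have Xrho t : 0 <= t -> l2le (X t) rho.
  have h0 : 0 < (2 * d + K)^-1 by rewrite invr_gt0; lra.
  move=> t0; have := exponential_decay k0 h0
    (lattice_field_contraction d0 k0 tslope) _ expX B00 B0rho.
  rewrite X0 => /(_ _ psi0B0 t t0) H.
  apply: le_l2le (H _) => [|s s0].
    apply: le_trans B0rho; rewrite ler_piMr ?(ltW B00)// -[leRHS]expR0 ler_expR.
    by rewrite mulNr oppr_le0 mulr_ge0// divr_ge0// ltW.
  exists (C * (B0 + `|b s - b 0|)); apply: Gbound.
  have := l2leD psi0B0 (mX 0 s (lexx 0) s0); apply: eq_l2le => i.
  by rewrite X0 addrC subrK.
have GF t : 0 <= t -> G (X t) = F (X t).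
  move=> t0; apply/funext => i; rewrite /G /F /lattice_field /tphi clamp_id//.
  exact: l2le_coord (Xrho t t0).
exists X; split=> //.
- by move=> t t0; exists (C * rho); rewrite -GF//; apply/Gbound/Xrho.
- by move=> t t0 e e0; rewrite -GF//; exact: expX.
- move=> t t0 e e0; have [r r0 Hr] := small t e e0; exists r => // t' t'0 t'r.
  by rewrite -!GF//; apply: le_l2le (GX t t' t0 t'0); exact: Hr.
Qed.

(** Slopes between two arbitrary points of the ball serve existence, through the Lipschitz bound;
    slopes from the origin serve the decay of every solution. *)
Lemma asymptotic_stability (d K k rho : R) (g : R -> R) (u : int -> R) :
  0 < d -> 0 < k -> 0 < rho ->
  (forall i v w, `|v| <= rho -> `|w| <= rho ->
     exists2 c, - K <= c <= - k & g (u i + v) - g (u i + w) = c * (v - w)) ->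
  locally_asymptotically_l2_stable d g u.
Proof.
move=> d0 k0 rho0 slope.
pose phi i v := g (u i + v) - g (u i).
have phi0 i : phi i 0 = 0 by rewrite /phi addr0 subrr.
have pslope i v w : `|v| <= rho -> `|w| <= rho ->
    exists2 c, - K <= c <= - k & phi i v - phi i w = c * (v - w).
  move=> vr wr; have [c cI E] := slope i v w vr wr; exists c => //.
  by rewrite -E /phi; ring.
have FE : perturbation_field d g u = lattice_field d phi by exact: perturbation_fieldE.
have zslope i v : `|v| <= rho -> exists2 c, - K <= c <= - k & phi i v = c * v.
  move=> vr; have [||c cI E] := pslope i v 0; rewrite ?normr0 ?(ltW rho0)//.
  by exists c => //; move: E; rewrite phi0 !subr0.
have kK : k <= K.
  by have [||c] := slope 0 0 0; rewrite ?normr0 ?(ltW rho0)//; lra.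
have h0 : 0 < (2 * d + K)^-1 by rewrite invr_gt0; lra.
have ex B0 psi0 : 0 < B0 -> B0 <= rho -> l2le psi0 B0 ->
    exists psi, classical_solution d g u psi0 psi.
  move=> B00 B0rho psi0B0.
  have [psi [psi0E psirho Fpsi epsi cpsi]] :=
    lattice_solution_exists d0 k0 B00 B0rho psi0B0 phi0 pslope.
  exists psi; apply: expansion_classical_solution; rewrite ?FE//.
  by move=> t /psirho; exists rho.
have decay B0 psi0 psi : 0 < B0 -> B0 <= rho -> l2le psi0 B0 ->
    classical_solution d g u psi0 psi -> forall t, 0 <= t ->
    l2norm (psi t) <= B0 * expR (- (k / 2) * t).
  move=> B00 B0rho psi0B0 sol t t0.
  have := classical_solution_expansion sol; have [psi0E _ F2 _ _] := sol.
  rewrite FE in F2 * => epsi; apply: (l2le_in_l2 _).2.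
  apply: (exponential_decay k0 h0 (lattice_field_contraction d0 k0 zslope) _ epsi) => //.
    by move=> s /F2/in_l2_l2le; exists (l2norm (lattice_field d phi (psi s))).
  by rewrite psi0E.
split.
  move=> e e0; have m0 : 0 < Num.min (e / 2) rho by rewrite lt_min rho0 divr_gt0.
  have [me mr] : Num.min (e / 2) rho <= e / 2 /\ Num.min (e / 2) rho <= rho.
    by split; rewrite ge_min lexx ?orbT.
  exists (Num.min (e / 2) rho) => // psi0 /in_l2_l2le psi02 psi0m.
  have psi0B : l2le psi0 (Num.min (e / 2) rho) by apply: le_l2le psi02; exact: ltW.
  split; first exact: ex m0 mr psi0B.
  move=> psi sol t t0; apply: le_lt_trans (decay _ _ _ m0 mr psi0B sol t t0) _.
  apply: (@le_lt_trans _ _ (Num.min (e / 2) rho)); last by lra.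
  rewrite ler_piMr ?(ltW m0)// -[leRHS]expR0 ler_expR.
  by rewrite mulNr oppr_le0 mulr_ge0// divr_ge0// ltW.
exists rho => // psi0 /in_l2_l2le psi02 psi0r.
have psi0B : l2le psi0 rho by apply: le_l2le psi02; exact: ltW.
split; first exact: ex rho0 (lexx _) psi0B.
move=> psi sol.
have cv : rho * expR (- (k / 2) * t) @[t --> +oo] --> 0.
  rewrite -(mulr0 rho); apply: cvgMr; under eq_fun do rewrite mulNr.
  apply: (@cvg_comp _ _ _ (fun t => k / 2 * t) (fun v => expR (- v))
    _ _ _ _ (@cvgr_expR R)).
  by apply: gt0_cvgMry; [rewrite divr_gt0|exact: cvg_id].
apply: (@squeeze_cvgr _ _ _ _ (cst 0) (fun t => rho * expR (- (k / 2) * t))) => //.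
  near=> t; apply/andP; split; first exact: sqrtr_ge0.
  by apply: (decay _ _ _ rho0 (lexx _) psi0B sol).
exact: cvg_cst.
Unshelve. all: by end_near. Qed.

End LatticeStability.

(** * Instability from one steep site *)

Section LatticeInstability.
Variable R : realType.

(* The linear extension to negative times makes the one-sided derivative
   at time 0 two-sided. *)
Lemma expansion_coord (F : (int -> R) -> int -> R) psi i : l2_expansion F psi ->
  exists q : R -> R, (forall t, 0 <= t -> q t = psi t i) /\
    forall t : R, 0 <= t -> is_derive t 1 q (F (psi t) i).
Proof.
move=> epsi.
pose q (t : R) : R := if 0 <= t then psi t i else psi 0 i + t * F (psi 0) i.
have qE t : 0 <= t -> q t = psi t i by rewrite /q => ->.
exists q; split=> // t t0; apply: is_derive_of_expansion => e e0.
have [r r0 Hr] := epsi t t0 e e0.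
exists (if t == 0 then r else Num.min r t).
  by case: eqVneq => // tn0; rewrite lt_min r0 lt_def tn0.
move=> y yt.
have yr : `|y - t| < r.
  by move: yt; case: eqVneq => // _; rewrite lt_min => /andP[].
have [y0|y0] := leP 0 y.
  by rewrite !qE//; exact: l2le_coord (Hr y y0 yr).
have t00 : t = 0.
  apply/eqP; move: yt; case: eqVneq => // _; rewrite lt_min => /andP[_].
  by rewrite distrC ger0_norm ?subr_ge0 ?(le_trans (ltW y0))//; lra.
rewrite t00 (qE 0)// /q (leNgt 0 y) y0/= subr0.
rewrite [X in `|X|](_ : _ = 0) ?normr0; last by ring.
by rewrite mulr_ge0// ltW.
Qed.

Lemma is_derive_expM (c : R) (q : R -> R) (dq t : R) : is_derive t 1 q dq ->
  is_derive t 1 (fun t => expR (c * t) * q t) (expR (c * t) * (c * q t + dq)).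
Proof.
move=> dqt.
have h : is_derive t 1 (fun t : R => c * t) c.
  by rewrite -[X in is_derive _ _ _ X]mulr1; exact: is_deriveZ.
have e : is_derive t 1 (fun t => expR (c * t)) (expR (c * t) * c).
  exact: is_derive1_comp.
have -> : expR (c * t) * (c * q t + dq) =
    expR (c * t) *: dq + q t *: (expR (c * t) * c).
  by rewrite /GRing.scale/=; ring.
exact: (@is_deriveM _ _ (fun t => expR (c * t)) q).
Qed.

(** A comparison principle for bounded solutions that needs no minimal site: starting from the bound
    by [rho], the lower bound is halved at every pass, so the negative part is squeezed to 0. *)
Lemma lattice_nonneg (d K rho : R) phi (psi : R -> int -> R) :
  0 < d -> 0 < K ->
  (forall i v, `|v| <= rho -> `|phi i v| <= K * `|v|) ->
  l2_expansion (lattice_field d phi) psi ->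
  (forall t i, 0 <= t -> `|psi t i| <= rho) ->
  (forall i, 0 <= psi 0 i) ->
  forall t i, 0 <= t -> 0 <= psi t i.
Proof.
move=> d0 K0 phiK epsi bpsi psi00.
have rho0 : 0 <= rho by apply: le_trans (bpsi 0 0 (lexx 0)).
pose L := 2 * d + 3 * K.
(* A lower bound -B e^(L t) valid at all sites improves to its half. *)
have half B : 0 <= B ->
    (forall t i, 0 <= t -> - (B * expR (L * t)) <= psi t i) ->
    forall t i, 0 <= t -> - (B / 2 * expR (L * t)) <= psi t i.
  move=> B0 HB t i t0.
  have [q [qE dq]] := expansion_coord i epsi.
  (* The integrating factor cancels [- 2 * d * p] and leaves [K * p + f], which is at least
     [- 2 * K * (B * E)]; the neighbours contribute at least [- 2 * d * (B * E)]. The value of [L]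
     makes [(c + L) / 2] equal to [2 * K + 2 * d], which compensates both. *)
  pose c := K + 2 * d.
  pose w (s : R) : R := expR (c * s) * (q s + B / 2 * expR (L * s)).
  pose dw (s : R) : R := expR (c * s) * (c * (q s + B / 2 * expR (L * s)) +
    (lattice_field d phi (psi s) i + B / 2 * (expR (L * s) * L))).
  have dE (s : R) : is_derive s 1 (fun s => B / 2 * expR (L * s))
      (B / 2 * (expR (L * s) * L)).
    have h : is_derive s 1 (fun s : R => L * s) L.
      by rewrite -[X in is_derive _ _ _ X]mulr1; exact: is_deriveZ.
    have e : is_derive s 1 (fun s => expR (L * s)) (expR (L * s) * L).
      exact: is_derive1_comp.
    exact: is_deriveZ.
  have dwP (s : R) : 0 <= s -> is_derive s 1 w (dw s).
    move=> s0; apply: is_derive_expM; have := dq s s0; have := dE s => d1 d2.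
    exact: is_deriveD.
  have dw0 (s : R) : 0 <= s -> 0 <= dw s.
    move=> s0; rewrite mulr_ge0 ?expR_ge0// qE// /lattice_field.
    have := HB s i s0; have := HB s (i - 1) s0; have := HB s (i + 1) s0.
    have := phiK i (psi s i) (bpsi s i s0).
    set E := expR (L * s); set p := psi s i; set pl := psi s _; set pr := psi s _.
    set f := phi i p.
    move=> fp Hr Hl Hp.
    have BE : 0 <= B * E by rewrite mulr_ge0 ?expR_ge0.
    have f1 : - (2 * K * (B * E)) <= K * p + f.
      have KBE : 0 <= K * (B * E) by rewrite mulr_ge0 ?(ltW K0).
      have KH := ler_wpM2l (ltW K0) Hp.
      move: fp; rewrite ler_norml; have [p0|p0] := ger0P p; lra.
    have f2 : - (2 * d * (B * E)) <= d * (pl + pr).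
      have dl := ler_wpM2l (ltW d0) Hl; have dr := ler_wpM2l (ltW d0) Hr.
      by lra.
    rewrite /c /L; lra.
  have := deriv_ge0_le_ray t0 dwP dw0.
  rewrite /w !mulr0 expR0 !qE// mulr1 mul1r => h.
  have : 0 <= expR (c * t) * (psi t i + B / 2 * expR (L * t)).
    by apply: le_trans h; have := psi00 i; lra.
  by rewrite pmulr_rge0 ?expR_gt0//; lra.
have all_n n t i : 0 <= t -> - (rho / 2 ^+ n * expR (L * t)) <= psi t i.
  elim: n t i => [|n IH] t i t0.
    rewrite expr0 divr1 lerNl (le_trans (ler_norm _))// normrN.
    apply: le_trans (bpsi t i t0) _; rewrite ler_peMr// -[leLHS]expR0 ler_expR.
    by rewrite mulr_ge0// /L; lra.
  rewrite exprS invfM (mulrC 2^-1) mulrA; apply: half => //.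
  by rewrite divr_ge0// exprn_ge0.
move=> t i t0.
have : Num.min (psi t i) 0 = 0.
  apply: (@geometric_squeeze0 _ _ (rho * expR (L * t))) => n.
  rewrite ler0_norm ?ge_min ?lexx ?orbT// lerNl le_min oppr_le0 mulrAC.
  by rewrite all_n//= mulr_ge0 ?expR_ge0// divr_ge0// exprn_ge0.
by move=> /min_idPr.
Qed.

Lemma instability (d K rho nu : R) (g : R -> R) (u : int -> R) (i0 : int) :
  0 < d -> 0 < K -> 0 < rho -> 0 < nu ->
  (forall i v, `|v| <= rho -> `|g (u i + v) - g (u i)| <= K * `|v|) ->
  (forall v, 0 <= v <= rho -> (2 * d + nu) * v <= g (u i0 + v) - g (u i0)) ->
  l2_unstable d g u.
Proof.
move=> d0 K0 rho0 nu0 gK gnu stab.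
have [delta delta0 H] := stab rho rho0.
pose e := delta / 2; have e0 : 0 < e by rewrite divr_gt0.
pose psi0 : int -> R := fun i => if i == i0 then e else 0.
have [psi02 psi0e] := l2le_in_l2 (l2le_unit i0 e).
(* The assumed stability itself provides the solution, by the existence half of
   [solution_satisfies]. *)
have [|[psi sol] /(_ _ sol) small] := H psi0 psi02.
  by apply: le_lt_trans psi0e _; rewrite gtr0_norm// /e; lra.
have := classical_solution_expansion sol; rewrite perturbation_fieldE => epsi.
have [psi0E psi2 _ _ _] := sol.
have bpsi t i : 0 <= t -> `|psi t i| <= rho.
  move=> t0; apply: le_trans (l2le_coord i (in_l2_l2le (psi2 t t0))) _.
  exact/ltW/small.
have pos : forall t i, 0 <= t -> 0 <= psi t i.
  apply: (lattice_nonneg d0 K0 _ epsi bpsi) => [i v|i]; first exact: gK.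
  by rewrite psi0E /psi0; case: ifP => // _; exact: ltW.
have [q [qE dq]] := expansion_coord i0 epsi.
have dq_ge (t : R) : 0 <= t -> nu * q t <=
    lattice_field d (fun i v => g (u i + v) - g (u i)) (psi t) i0.
  move=> t0; rewrite qE// /lattice_field.
  have := gnu (psi t i0); rewrite pos//= (le_trans (ler_norm _) (bpsi t i0 t0)).
  move=> /(_ isT).
  have := mulr_ge0 (ltW d0) (pos t (i0 - 1) t0).
  have := mulr_ge0 (ltW d0) (pos t (i0 + 1) t0).
  lra.
have q0 : q 0 = e by rewrite qE// psi0E /psi0 eqxx.
have qe (t : R) : 0 <= t -> e <= q t.
  move=> t0; rewrite -q0; apply: (deriv_ge0_le_ray t0 dq) => s s0.
  by apply: le_trans (dq_ge s s0); rewrite mulr_ge0 ?(ltW nu0)// qE// pos.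
have lin (t : R) : 0 <= t -> nu * e * t <= q t.
  move=> t0.
  have dd (s : R) : 0 <= s -> is_derive s 1 (fun s => q s - nu * e * s)
     (lattice_field d (fun i v => g (u i + v) - g (u i)) (psi s) i0 - nu * e).
    move=> s0; have := dq s s0 => dqs; apply: is_deriveB.
    by rewrite -[X in is_derive _ _ _ X]mulr1; exact: is_deriveZ.
  have := deriv_ge0_le_ray t0 dd; rewrite mulr0 subr0 q0 => h.
  suff : e <= q t - nu * e * t by lra.
  apply: h => s s0; rewrite subr_ge0; apply: le_trans (dq_ge s s0).
  by rewrite ler_wpM2l ?(ltW nu0)// qe.
(* Linear growth is enough: at time [T] the bound [nu * e * t] reaches [2 * rho], while the solution
   stays below [rho]. *)
pose T := 2 * rho / (nu * e).
have ne : 0 < nu * e by rewrite mulr_gt0.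
have T0 : 0 <= T by rewrite divr_ge0 ?(ltW ne)// mulr_ge0// ltW.
have := lin T T0; rewrite /T mulrC divfK ?gt_eqF// -/T qE//.
have := le_trans (ler_norm _) (bpsi T i0 T0); lra.
Qed.

End LatticeInstability.

(** * The nine key roots and the choice of [d0] *)

Section KeyRoots.
Variable R : realType.
Implicit Types (f df g : R -> R).

Lemma within_is_derive f (x l : R) : 0 < x < 1 ->
  is_derive_within `[0, 1] f x l -> is_derive x 1 f l.
Proof.
move=> /andP[x0 x1] /cvg_within_dnbhsP H; apply: is_derive_of_expansion => e e0.
have [r r0 Hr] := H e e0.
exists (Num.min r (Num.min x (1 - x))); first by rewrite !lt_min r0 x0 subr_gt0.
move=> y; rewrite !lt_min => /and3P[yr yx yx1].
have [->|yn] := eqVneq y x; first by rewrite !subrr mul0r subr0 normr0 mulr0.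
have y01 : `[0, 1]%classic y.
  by rewrite /= in_itv/=; move: yx yx1; rewrite !ltr_norml; lra.
have := Hr y y01 yn yr.
have yx0 : y - x != 0 by rewrite subr_eq0.
rewrite -(@ler_pM2r _ `|y - x|) ?normr_gt0// -normrM.
by congr (`|_| <= _); field.
Qed.

Lemma within_derive_continuous f f1 :
  (forall x, 0 <= x <= 1 -> is_derive_within `[0, 1] f x (f1 x)) ->
  {within `[0, 1], continuous f}.
Proof.
move=> df; apply/subspace_continuousP => x /= x01.
apply/cvgrPdist_le => e e0.
have /cvg_within_dnbhsP/(_ 1 ltr01)[r r0 Hr] := df x x01.
pose B := `|f1 x| + 1; have B0 : 0 < B by rewrite /B ltr_wpDl.
apply/nbhs_ballP; exists (Num.min r (e / B)); first by rewrite /= lt_min r0 divr_gt0.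
move=> y; rewrite /ball/= distrC lt_min => /andP[yr ye] y01.
have [->|yn] := eqVneq y x; first by rewrite subrr normr0 ltW.
have yx0 : y - x != 0 by rewrite subr_eq0.
have h : `|(f y - f x) / (y - x)| <= B.
  have := Hr y y01 yn yr; rewrite /B.
  have := ler_normD ((f y - f x) / (y - x) - f1 x) (f1 x); rewrite subrK.
  lra.
rewrite distrC -[f y - f x](divfK yx0) normrM.
apply: le_trans (_ : B * (e / B) <= _); last by rewrite mulrC divfK// gt_eqF.
by apply: ler_pM => //; exact: ltW.
Qed.

Lemma subitv_continuous f (a b : R) : 0 <= a -> b <= 1 ->
  {within `[0, 1], continuous f} -> {within `[a, b], continuous f}.
Proof.
move=> a0 b1; apply: continuous_subspaceW => x /=; rewrite !in_itv/= => /andP[ax xb].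
by rewrite (le_trans a0 ax) (le_trans xb b1).
Qed.

Lemma deriv_gt0_lt f df (a b : R) : a < b ->
  (forall x, a < x < b -> is_derive x 1 f (df x)) ->
  {within `[a, b], continuous f} ->
  (forall x, a < x < b -> 0 < df x) -> f a < f b.
Proof.
move=> ab fdf fc df0.
have fdf' x : x \in `]a, b[%R -> is_derive x 1 f (df x).
  by rewrite in_itv/=; exact: fdf.
have [c cab E] := MVT ab fdf' fc.
by rewrite -subr_gt0 E mulr_gt0 ?subr_gt0// df0.
Qed.

(* h crosses each level in [0, 2] once increasing on [0, a1], once decreasing
   on [b1, b2] and once increasing on [a2, 1], and stays off [0, 2] in
   between. *)
Lemma three_crossings (h : R -> R) (a1 b1 b2 a2 c : R) :
  0 <= a1 -> a1 <= b1 -> b1 <= b2 -> b2 <= a2 -> a2 <= 1 ->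
  {within `[0, 1], continuous h} ->
  (forall x y, 0 <= x -> x < y -> y <= a1 -> h x < h y) ->
  (forall x y, b1 <= x -> x < y -> y <= b2 -> h y < h x) ->
  (forall x y, a2 <= x -> x < y -> y <= 1 -> h x < h y) ->
  (forall x, a1 <= x <= b1 -> 2 < h x) ->
  (forall x, b2 <= x <= a2 -> h x < 0) ->
  h 0 <= c -> 0 <= c <= 2 -> c <= h 1 ->
  exists x y z : R, [/\ 0 <= x < a1, b1 < y < b2, a2 < z <= 1,
    [/\ h x = c, h y = c & h z = c] &
    forall w, 0 <= w <= 1 -> (h w = c <-> w \in [:: x; y; z])].
Proof.
move=> a10 ab1 b12 ba2 a21 hc inc dec inc' gt2 lt0 h0c /andP[c0 c2] ch1.
have ha1 : 2 < h a1 by apply: gt2; rewrite lexx.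
have hb1 : 2 < h b1 by apply: gt2; rewrite lexx andbT.
have hb2 : h b2 < 0 by apply: lt0; rewrite lexx.
have ha2 : h a2 < 0 by apply: lt0; rewrite lexx andbT.
have [||x xI hx] := @IVT _ h 0 a1 c a10.
- by apply: subitv_continuous => //; lra.
- by rewrite ge_min le_max h0c orTb/= (le_trans c2 (ltW ha1)) orbT.
have [||y yI hy] := @IVT _ h b1 b2 c b12.
- by apply: subitv_continuous => //; lra.
- by rewrite ge_min le_max (le_trans (ltW hb2) c0) (le_trans c2 (ltW hb1)) orbT.
have [||z zI hz] := @IVT _ h a2 1 c a21.
- by apply: subitv_continuous => //; lra.
- by rewrite ge_min le_max (le_trans (ltW ha2) c0) ch1 orbT.
rewrite !in_itv/= in xI yI zI.
have xa1 : x != a1 by apply: contraTneq ha1 => <-; rewrite hx -leNgt.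
have yb1 : y != b1 by apply: contraTneq hb1 => <-; rewrite hy -leNgt.
have yb2 : y != b2 by apply: contraTneq hb2 => <-; rewrite hy -leNgt.
have za2 : z != a2 by apply: contraTneq ha2 => <-; rewrite hz -leNgt.
case/andP: xI => x0 xa; case/andP: yI => by1 yb; case/andP: zI => az z1.
exists x, y, z; split=> //.
- by rewrite x0 lt_def eq_sym xa1.
- by rewrite !lt_def yb1 by1 eq_sym yb2.
- by rewrite lt_def za2 az.
move=> w /andP[w0 w1]; rewrite !inE; split; last by move=> /or3P[]/eqP->.
move=> hw; have [wa|wa] := leP w a1.
  have [wx|xw|->] := ltgtP w x; last by rewrite ?eqxx.
    by have := inc w x w0 wx xa; rewrite hx hw ltxx.
  by have := inc x w x0 xw wa; rewrite hx hw ltxx.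
have [wb1|wb1] := leP w b1.
  by have := gt2 w; rewrite (ltW wa) wb1 hw ltNge c2 => /(_ isT).
have [wb2|wb2] := leP w b2.
  have [wx|xw|->] := ltgtP w y; last by rewrite ?eqxx ?orbT.
    by have := dec w y (ltW wb1) wx yb; rewrite hy hw ltxx.
  by have := dec y w by1 xw wb2; rewrite hy hw ltxx.
have [wa2|wa2] := leP w a2.
  by have := lt0 w; rewrite (ltW wb2) wa2 hw ltNge c0 => /(_ isT).
have [wx|xw|->] := ltgtP w z; last by rewrite ?eqxx ?orbT.
  by have := inc' w z (ltW wa2) wx z1; rewrite hz hw ltxx.
by have := inc' z w az xw w1; rewrite hz hw ltxx.
Qed.

(** On the middle branch [h] decreases, so its roots for the levels 2, 1, 0 come in this order; this
    is the source of the index triples 0, 5, 6 and 1, 4, 7 and 2, 3, 8. *)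
Lemma nine_roots (h : R -> R) (a1 b1 b2 a2 : R) :
  0 <= a1 -> a1 <= b1 -> b1 <= b2 -> b2 <= a2 -> a2 <= 1 ->
  {within `[0, 1], continuous h} ->
  (forall x y, 0 <= x -> x < y -> y <= a1 -> h x < h y) ->
  (forall x y, b1 <= x -> x < y -> y <= b2 -> h y < h x) ->
  (forall x y, a2 <= x -> x < y -> y <= 1 -> h x < h y) ->
  (forall x, a1 <= x <= b1 -> 2 < h x) ->
  (forall x, b2 <= x <= a2 -> h x < 0) ->
  h 0 = 0 -> h 1 = 2 ->
  exists r : 9.-tuple R,
  [/\ forall x, 0 <= x <= 1 -> (h x = 0 <-> x \in [:: r`_0; r`_5; r`_6]),
      forall x, 0 <= x <= 1 -> (h x = 1 <-> x \in [:: r`_1; r`_4; r`_7]),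
      forall x, 0 <= x <= 1 -> (h x = 2 <-> x \in [:: r`_2; r`_3; r`_8]),
      sorted <%R r
    & r`_0 = 0 /\ r`_8 = 1] /\
  [/\ 0 <= r`_2 < a1, b1 < r`_3, r`_5 < b2 & a2 < r`_6 <= 1].
Proof.
move=> a10 ab1 b12 ba2 a21 hc inc dec inc' gt2 lt0 h0 h1.
have cross c : 0 <= c <= 2 -> exists x y z : R,
    [/\ 0 <= x < a1, b1 < y < b2, a2 < z <= 1, [/\ h x = c, h y = c & h z = c] &
    forall w, 0 <= w <= 1 -> (h w = c <-> w \in [:: x; y; z])].
  move=> /[dup] cI /andP[c0 c2].
  by apply: (three_crossings _ _ _ _ _ hc inc dec inc' gt2 lt0) => //; rewrite ?h0 ?h1.
have lt01 : (0 : R) < 1 := ltr01.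
have lt12 : (1 : R) < 2 by rewrite ltr1n.
have [|x0 [y0 [z0 [x0I y0I z0I [hx0 hy0 hz0] r0]]]] := cross 0.
  by rewrite lexx ler0n.
have [|x1 [y1 [z1 [x1I y1I z1I [hx1 hy1 hz1] r1]]]] := cross 1.
  by rewrite ler01 ler1n.
have [|x2 [y2 [z2 [x2I y2I z2I [hx2 hy2 hz2] r2]]]] := cross 2.
  by rewrite lexx ler0n.
have inL x y : 0 <= x < a1 -> 0 <= y < a1 -> h x < h y -> x < y.
  move=> /andP[_ xa] /andP[y0' _] hxy; rewrite ltNge le_eqVlt; apply/negP.
  move=> /predU1P[E|yx]; first by rewrite E ltxx in hxy.
  by have := inc y x y0' yx (ltW xa); rewrite ltNge (ltW hxy).
have inM x y : b1 < x < b2 -> b1 < y < b2 -> h y < h x -> x < y.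
  move=> /andP[_ xb] /andP[yb _] hxy; rewrite ltNge le_eqVlt; apply/negP.
  move=> /predU1P[E|yx]; first by rewrite E ltxx in hxy.
  by have := dec y x (ltW yb) yx (ltW xb); rewrite ltNge (ltW hxy).
have inH x y : a2 < x <= 1 -> a2 < y <= 1 -> h x < h y -> x < y.
  move=> /andP[_ x1'] /andP[ya _] hxy; rewrite ltNge le_eqVlt; apply/negP.
  move=> /predU1P[E|yx]; first by rewrite E ltxx in hxy.
  by have := inc' y x (ltW ya) yx x1'; rewrite ltNge (ltW hxy).
have x01 : x0 < x1 by apply: inL; rewrite // hx0 hx1.
have x12 : x1 < x2 by apply: inL; rewrite // hx1 hx2.
have y21 : y2 < y1 by apply: inM; rewrite // hy1 hy2.
have y10 : y1 < y0 by apply: inM; rewrite // hy1 hy0.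
have z01 : z0 < z1 by apply: inH; rewrite // hz0 hz1.
have z12 : z1 < z2 by apply: inH; rewrite // hz1 hz2.
case/andP: (x2I) => x20 x2a; case/andP: (y2I) => by2 y2b.
case/andP: (y0I) => by0 y0b; case/andP: (z0I) => az0 z01'.
have xy : x2 < y2 by apply: lt_le_trans x2a (le_trans ab1 (ltW by2)).
have yz : y0 < z0 by apply: lt_le_trans y0b (le_trans ba2 (ltW az0)).
have x0E : x0 = 0.
  case/andP: x0I => x0' x0a; apply/eqP; rewrite eq_le x0' andbT leNgt.
  by apply/negP => /(inc 0 x0 (lexx 0))/(_ (ltW x0a)); rewrite h0 hx0 ltxx.
have z2E : z2 = 1.
  case/andP: z2I => az2 z2'; apply/eqP; rewrite eq_le z2' leNgt.
  by apply/negP => /(inc' z2 1 (ltW az2))/(_ (lexx 1)); rewrite h1 hz2 ltxx.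
exists [tuple x0; x1; x2; y2; y1; y0; z0; z1; z2].
split; split=> //=; first by rewrite x01 x12 xy y21 y10 yz z01 z12.
Qed.

Lemma key_roots_exist (g g1 g2 : R -> R) (a a1 a2 : R) :
  C2_unit_interval g g1 g2 -> bistable g g1 a a1 a2 ->
  exists2 d0 : R, 0 < d0 & forall d : R, 0 < d < d0 ->
  exists2 r : 9.-tuple R, key_roots g d r &
    [/\ 0 <= r`_2 < a1, a1 < r`_3, r`_5 < a2, a2 < r`_6 <= 1 &
        forall x, r`_3 <= x <= r`_5 -> 2 * d < g1 x].
Proof.
move=> [dg dg1 _] [[g0 ga g1'] [a10 a1a aa2 a21] neg pos].
have gc := within_derive_continuous dg.
have g1c := within_derive_continuous dg1.
have gd (x : R) : 0 < x < 1 -> is_derive x 1 g (g1 x).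
  move=> x01; apply: within_is_derive => //; apply: dg.
  by case/andP: x01 => /ltW-> /ltW->.
have gdec x y : 0 <= x -> x < y -> y <= 1 -> (y <= a1 \/ a2 <= x) -> g y < g x.
  move=> x0 xy y1 side.
  have dN (z : R) : x < z < y -> is_derive z 1 (- g) (- g1 z).
    move=> zI; have : is_derive z 1 g (g1 z) by apply: gd; lra.
    by move=> ?; exact: is_deriveN.
  have := @deriv_gt0_lt (- g) (fun z => - g1 z) x y xy dN.
  rewrite /GRing.opp/= ltrN2; apply.
    have := subitv_continuous x0 y1 gc => c; move=> z; apply: continuousN; exact: c.
  by move=> z zI; rewrite oppr_gt0; apply: neg; case: side => side; lra.
have ginc x y : a1 <= x -> x < y -> y <= a2 -> g x < g y.
  move=> x1 xy y1; apply: (deriv_gt0_lt (df := g1) xy) => [z zI||z zI].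
  - by apply: gd; lra.
  - by apply: subitv_continuous => //; lra.
  - by apply: pos; lra.
(* Near [a1] and [a2] the slope of [g] may be too small for [h] to be monotone. There [g] itself
   stays away from 0, which pushes [h] off [[0, 2]]; monotonicity is claimed only on [[b1, b2]]. *)
pose b1 := (a1 + a) / 2; pose b2 := (a + a2) / 2.
have [ab1 b1a ab2 b2a] : [/\ a1 < b1, b1 < a, a < b2 & b2 < a2].
  by rewrite /b1 /b2; split; lra.
have gb1 : g b1 < 0 by rewrite -ga; apply: ginc; lra.
have gb2 : 0 < g b2 by rewrite -ga; apply: ginc; lra.
have [||c cI cmin] := @EVT_min _ g1 b1 b2; first by lra.
  by apply: subitv_continuous => //; lra.
have m0 : 0 < g1 c by apply: pos; move: cI; rewrite in_itv/=; lra.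
(* The three bounds give, in this order, slope above [2 * d] on [[b1, b2]], [h > 2] on [[a1, b1]]
   and [h < 0] on [[b2, a2]]. *)
exists (Num.min (g1 c / 2) (Num.min (- g b1 / 2) (g b2 / 2))).
  by rewrite !lt_min !divr_gt0// oppr_gt0.
move=> d /andP[d0]; rewrite !lt_min => /and3P[dm db1 db2].
pose h := hfun g d.
have hE x y : d * (h y - h x) = 2 * d * (y - x) - (g y - g x).
  by rewrite /h /hfun; field; rewrite gt_eqF.
have h_lt x y : g y - g x < 2 * d * (y - x) -> h x < h y.
  by move=> H; rewrite -subr_gt0 -(pmulr_rgt0 _ d0) hE subr_gt0.
have h_gt x y : 2 * d * (y - x) < g y - g x -> h y < h x.
  by move=> H; rewrite -subr_lt0 -(pmulr_rlt0 _ d0) hE subr_lt0.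
have hc : {within `[0, 1], continuous h}.
  have c2 : {within `[0, 1], continuous (fun x : R => 2 * x)}.
    by apply: continuous_subspaceT => x; apply: cvgMr; exact: cvg_id.
  by move=> x; apply: cvgB; [exact: c2|apply: cvgMr; exact: gc].
have out x y : 0 <= x -> x < y -> y <= 1 -> (y <= a1 \/ a2 <= x) -> h x < h y.
  move=> x0 xy y1 side; apply: h_lt; have := gdec x y x0 xy y1 side.
  have : 0 < 2 * d * (y - x) by rewrite !mulr_gt0// subr_gt0.
  by lra.
have g1gt x : b1 <= x <= b2 -> 2 * d < g1 x.
  move=> xI; have := cmin x; rewrite in_itv/= xI => /(_ isT).
  by lra.
have mid x y : b1 <= x -> x < y -> y <= b2 -> h y < h x.
  move=> bx xy yb; apply: h_gt.
  have dI (z : R) : z \in `]x, y[%R -> is_derive z 1 g (g1 z).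
    by rewrite in_itv/= => zI; apply: gd; lra.
  have [|z] := MVT xy dI; first by apply: subitv_continuous => //; lra.
  rewrite in_itv/= => zI ->; rewrite ltr_pM2r ?subr_gt0//.
  by apply: g1gt; lra.
have hi x : a1 <= x <= b1 -> 2 < h x.
  move=> /andP[ax xb].
  have gx : g x <= g b1.
    move: xb; rewrite le_eqVlt => /predU1P[->//|xb].
    by apply: ltW; apply: ginc; lra.
  rewrite -subr_gt0 -(pmulr_rgt0 _ d0).
  have -> : d * (h x - 2) = 2 * d * x - g x - 2 * d.
    by rewrite /h /hfun; field; rewrite gt_eqF.
  have : 0 <= d * x by rewrite mulr_ge0 ?(ltW d0)//; lra.
  by lra.
have lo x : b2 <= x <= a2 -> h x < 0.
  move=> /andP[bx xa].
  have gx : g b2 <= g x.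
    move: bx; rewrite le_eqVlt => /predU1P[->//|bx].
    by apply: ltW; apply: ginc; lra.
  rewrite -(pmulr_rlt0 _ d0).
  have -> : d * h x = 2 * d * x - g x.
    by rewrite /h /hfun; field; rewrite gt_eqF.
  have : d * x <= d * 1 by rewrite ler_pM2l//; lra.
  by lra.
have h0 : h 0 = 0 by rewrite /h /hfun g0; ring.
have h1 : h 1 = 2 by rewrite /h /hfun g1'; ring.
have [r [kr [r2 r3 r5 r6]]] : exists r : 9.-tuple R, key_roots g d r /\
    [/\ 0 <= r`_2 < a1, b1 < r`_3, r`_5 < b2 & a2 < r`_6 <= 1].
  apply: (nine_roots (ltW a10) (ltW ab1) (ltW (lt_trans b1a ab2)) (ltW b2a)
            (ltW a21) hc _ mid _ hi lo h0 h1).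
  - by move=> x y x0 xy ya; apply: out => //; [lra|left].
  - by move=> x y ax xy y1; apply: out => //; [lra|right].
exists r => //; split=> //.
- exact: lt_trans r3.
- exact: lt_trans b2a.
- move=> x /andP[rx xr]; apply: g1gt.
  by rewrite (le_trans (ltW r3) rx) (le_trans xr (ltW r5)).
Qed.

End KeyRoots.

(** * From slopes of the extended nonlinearity to stability and instability *)

Section Extension.
Variable R : realType.

Lemma derive1_within (f : R -> R) (l : R) (x : R) : 0 <= x <= 1 ->
  derivable f x 1 -> is_derive_within `[0, 1] f x l -> derive1 f x = l.
Proof.
move=> /andP[x0 x1] dfx /cvg_within_dnbhsP dw.
have cv : h^-1 *: (f (h *: 1 + x) - f x) @[h --> 0^'] --> derive1 f x.
  by rewrite derive1E; exact: dfx.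
apply/eqP; rewrite -subr_eq0 -normr_le0; apply/ler_addgt0Pr => e e0; rewrite add0r.
have e20 : 0 < e / 2 by rewrite divr_gt0.
have [r r0 Hr] := dw _ e20.
have /cvgrPdist_le/(_ _ e20)/nbhs_ballP[r' /= r'0 Hr'] := cv.
pose m := Num.min (Num.min r r') 1 / 2.
have [m0 mr mr' m1] : [/\ 0 < m, m < r, m < r' & m <= 1 / 2].
  have : 0 < Num.min (Num.min r r') 1 by rewrite !lt_min r0 r'0 ltr01.
  have : Num.min (Num.min r r') 1 <= r by rewrite !ge_min lexx.
  have : Num.min (Num.min r r') 1 <= r' by rewrite !ge_min lexx orbT.
  have : Num.min (Num.min r r') 1 <= 1 by rewrite !ge_min lexx orbT.
  by rewrite /m; split; lra.
pose h := if x <= 1 / 2 then m else - m.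
have hm : `|h| = m by rewrite /h; case: ifP => _; rewrite ?normrN gtr0_norm.
have h0 : h != 0 by rewrite -normr_gt0 hm.
have xh : `[0, 1]%classic (h + x).
  by rewrite /= in_itv/= /h; case: ifPn; rewrite -?ltNge => ?; lra.
have := Hr (h + x) xh; rewrite addrK -subr_eq0 addrK hm => /(_ h0 mr) A.
have := Hr' h; rewrite /ball/= sub0r normrN hm => /(_ mr' h0) B.
have {B} : `|derive1 f x - (f (h + x) - f x) / h| <= e / 2.
  by move: B; rewrite /GRing.scale/= mulr1 [h^-1 * _]mulrC.
by move: A; rewrite !ler_norml; lra.
Qed.

Lemma slope_near (f : R -> R) (x y p r : R) : (forall z, derivable f z 1) ->
  `|x - p| <= r -> `|y - p| <= r ->
  exists2 z, `|z - p| <= r & f x - f y = derive1 f z * (x - y).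
Proof.
move=> df.
have dP (z : R) : is_derive z 1 f (derive1 f z).
  by rewrite derive1E; exact/derivableP.
wlog yx : x y / y <= x.
  move=> H; have [yx|/ltW xy] := leP y x; first exact: H.
  move=> xp yp; have [z zp E] := H y x xy yp xp.
  by exists z => //; rewrite -opprB E; ring.
move=> xp yp.
have [|z] := MVT_segment yx (fun z _ => dP z).
  by apply: derivable_within_continuous => z _; exact: df.
rewrite in_itv/= => zI E; exists z => //.
by move: xp yp; rewrite !ler_norml; lra.
Qed.

Lemma admissible_lipschitz (g ge : R -> R) : admissible_extension g ge ->
  exists2 M : R, 0 < M & forall x y, `|derive1 ge x - derive1 ge y| <= M * `|x - y|.
Proof.
move=> [_ [dge dge1 _] _ _ [M M0 HM]]; exists M => // x y.
have [||z _ ->] := @slope_near (derive1 ge) x y x `|x - y| dge1.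
- by rewrite subrr normr0.
- by rewrite distrC.
by rewrite normrM ler_wpM2r//; exact: HM.
Qed.

(** Within distance [k / M] of [u i] the slope moves by at most [k], hence stays below [- k]. The
    lower bound holds since all these points lie within [1 + k / M] of 0. *)
Lemma stable_of_slopes (d M k : R) (g : R -> R) (u : int -> R) :
  0 < d -> 0 < M -> 0 < k -> (forall x, derivable g x 1) ->
  (forall x y, `|derive1 g x - derive1 g y| <= M * `|x - y|) ->
  (forall i, 0 <= u i <= 1) -> (forall i, derive1 g (u i) <= - (2 * k)) ->
  locally_asymptotically_l2_stable d g u.
Proof.
move=> d_gt0 M0 k0 dge Mlip u01 kneg.
have rho0 : 0 < k / M by rewrite divr_gt0.
apply: (@asymptotic_stability _ d (`|derive1 g 0| + M * (1 + k / M)) k (k / M)) => //.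
move=> i v w vr wr.
have [||z zr E] := @slope_near g (u i + v) (u i + w) (u i) (k / M) dge.
- by rewrite addrC addKr.
- by rewrite addrC addKr.
exists (derive1 g z); last by rewrite E; ring.
have Mz := Mlip z (u i); have M0z := Mlip z 0; have ki := kneg i.
have : M * `|z - u i| <= k by rewrite mulrC -ler_pdivlMr.
have : M * `|z - 0| <= M * (1 + k / M).
  rewrite ler_pM2l// subr0; have := ler_normD (u i) (z - u i).
  rewrite addrC subrK; have := u01 i => /andP[ui0 ui1]; rewrite (ger0_norm ui0); lra.
have := lerNnormlW (lexx `|derive1 g 0|).
by move: Mz M0z; rewrite !ler_norml; lra.
Qed.

(** The excess [mu] of the slope over [2 * d] is halved: within [mu / (2 * M)] of [u i0] the slope
    remains above [2 * d + mu / 2]. The cap 1 on [rho] keeps all points within 2 of the origin,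
    which bounds the slopes at the other sites. *)
Lemma unstable_of_slope (d M : R) (g : R -> R) (u : int -> R) (i0 : int) :
  0 < d -> 0 < M -> (forall x, derivable g x 1) ->
  (forall x y, `|derive1 g x - derive1 g y| <= M * `|x - y|) ->
  (forall i, 0 <= u i <= 1) -> 2 * d < derive1 g (u i0) -> l2_unstable d g u.
Proof.
move=> d_gt0 M0 dge Mlip u01 steep.
pose mu := derive1 g (u i0) - 2 * d.
have mu0 : 0 < mu by rewrite subr_gt0.
pose rho := Num.min 1 (mu / (2 * M)).
have rho0 : 0 < rho by rewrite lt_min ltr01 divr_gt0// mulr_gt0.
have rho1 : rho <= 1 by rewrite ge_min lexx.
have Mrho : M * rho <= mu / 2.
  have : rho <= mu / (2 * M) by rewrite ge_min lexx orbT.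
  rewrite -(ler_pM2l M0); congr (_ <= _); by field; rewrite gt_eqF.
have near i v : `|v| <= rho -> exists2 z, `|z - u i| <= rho &
    g (u i + v) - g (u i) = derive1 g z * v.
  move=> vr; have [||z zr E] := @slope_near g (u i + v) (u i) (u i) rho dge.
  - by rewrite addrC addKr.
  - by rewrite subrr normr0 ltW.
  by exists z => //; rewrite E; ring.
apply: (@instability _ d (`|derive1 g 0| + M * 2) rho (mu / 2) _ _ i0) => //.
- by rewrite ltr_wpDl// mulr_gt0.
- by rewrite divr_gt0.
- move=> i v vr; have [z zr ->] := near i v vr; rewrite normrM ler_wpM2r//.
  have := Mlip z 0; have := ler_normD (derive1 g z - derive1 g 0) (derive1 g 0).
  rewrite subrK.
  have : M * `|z - 0| <= M * 2.
    rewrite ler_pM2l// subr0; have := ler_normD (u i) (z - u i).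
    rewrite addrC subrK; have := u01 i => /andP[ui0' ui1]; rewrite (ger0_norm ui0'); lra.
  by lra.
- move=> v /andP[v0 vr]; have [|z zr ->] := near i0 v; first by rewrite ger0_norm.
  rewrite ler_wpM2r//.
  have : M * `|z - u i0| <= M * rho by rewrite ler_pM2l.
  by have := Mlip z (u i0); rewrite ler_norml /mu in Mrho *; lra.
Qed.

End Extension.

Theorem theorem3 (R : realType) (g g1 g2 : R -> R) (a a1 a2 : R)
    (g_C2 : C2_unit_interval g g1 g2) (g_bistable : bistable g g1 a a1 a2) :
  exists2 d0 : R, 0 < d0 &
    forall d : R, 0 < d < d0 ->
    exists2 r : 9.-tuple R, key_roots g d r &
      forall (u : int -> R) (s : int -> symbol),
      stationary_solution g d u -> corresponds g d r u s ->
      forall ge : R -> R, admissible_extension g ge ->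
      [/\ forall i : int,
            (0 <= u i < a1) || (a2 < u i <= 1) <-> s i = sym0 \/ s i = sym1,
          forall i : int, a1 < u i < a2 <-> s i = syma,
          (forall i : int, (0 <= u i < a1) || (a2 < u i <= 1)) ->
            locally_asymptotically_l2_stable d ge u
        & (exists i0 : int, a1 < u i0 < a2) -> l2_unstable d ge u].
Proof.
have [d0 d00 roots] := key_roots_exist g_C2 g_bistable.
exists d0 => // d dI.
have [r kr [/andP[r20 r2] r3 r5 /andP[r6 r61] gmid]] := roots d dI.
exists r => // u s [u01 _] us ge gext.
have d_gt0 : 0 < d by case/andP: dI.
have [[_ _ _] [a10 a1a aa2 a21] gneg _] := g_bistable.
have [dg _ _] := g_C2.
have [geE [dge dge1 _] _ _ _] := gext.
have [M M0 Mlip] := admissible_lipschitz gext.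
have u_in i : match s i with
     | sym0 => 0 <= u i <= r`_2
     | syma => r`_3 <= u i <= r`_5
     | sym1 => r`_6 <= u i <= 1
     end by have [_ _ + _] := us i; case: (s i).
have ge1E x : 0 <= x <= 1 -> derive1 ge x = g1 x.
  move=> x01; apply: derive1_within => //.
  have /cvg_within_dnbhsP H := dg x x01; apply/cvg_within_dnbhsP => e e0.
  have [rr rr0 Hr] := H e e0; exists rr => // y y01 yx yr.
  by rewrite !geE//; exact: Hr.
have eq1 i : (0 <= u i < a1) || (a2 < u i <= 1) <-> s i = sym0 \/ s i = sym1.
  have := u_in i; case: (s i) => H; split=> //; try by [left|right].
  - by move=> _; apply/orP; left; lra.
  - by move=> ?; exfalso; lra.
  - by move=> [].
  - by move=> _; apply/orP; right; lra.
have eq2 i : a1 < u i < a2 <-> s i = syma.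
  have := u_in i; case: (s i) => H; split=> //; try (by move=> ?; exfalso; lra).
  by move=> _; lra.
split=> // [stable|[i0 /eq2 si0]].
- have c1 (x y : R) : {within `[x, y], continuous (derive1 ge)}.
    by apply: derivable_within_continuous => z _; exact: dge1.
  (* Uniformity over the sites comes from compactness: the slope attains a negative maximum on each
     of the intervals from 0 to [r]_2[and from]r[_6] to 1. *)
  have [k k0 kneg] : exists2 k, 0 < k & forall i, derive1 ge (u i) <= - (2 * k).
    have [p pI pmax] := EVT_max r20 (c1 0 r`_2).
    have [q qI qmax] := EVT_max r61 (c1 r`_6 1).
    rewrite in_itv/= in pI; rewrite in_itv/= in qI.
    have gp : derive1 ge p < 0 by rewrite ge1E; [apply: gneg|]; lra.
    have gq : derive1 ge q < 0 by rewrite ge1E; [apply: gneg|]; lra.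
    exists (Num.min (- derive1 ge p) (- derive1 ge q) / 2).
      by rewrite divr_gt0// lt_min !oppr_gt0 gp.
    move=> i; rewrite mulrC divfK// lerNr ge_min !lerN2.
    have /eq1[si|si] := stable i; have := u_in i; rewrite si => ui.
      by rewrite pmax.
    by rewrite qmax ?orbT.
  exact: stable_of_slopes d_gt0 M0 k0 dge Mlip u01 kneg.
have := u_in i0; rewrite si0 => ui0.
by apply: (unstable_of_slope d_gt0 M0 dge Mlip u01 (i0 := i0)); rewrite ge1E// gmid.
Qed.
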